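(* Let the graph limit $\Gamma\in\mathcal U_\infty$ be represented by a kernel $W$ on a probability space $(\mathcal S,\mu)$. Then $\Gamma$ is connected if and only if $W$ is connected.
   Context: Graphs are finite, simple, undirected, with at least one vertex; $v(G)=|V(G)|$, $e(G)=|E(G)|$. Graph limits. For graphs $F,G$, $t(F,G)$ is the probability that a uniformly random map $V(F)\to V(G)$ is a graph homomorphism (maps edges to edges). The set $\mathcal U$ of unlabelled graphs (isomorphism classes) is embedded as a dense subset of a compact metric space $\overline{\mathcal U}$; the elements of $\mathcal U_\infty=\overline{\mathcal U}\setminus\mathcal U$ are called graph limits, and $v(\Gamma)=\infty$ for $\Gamma\in\mathcal U_\infty$. Each $t(F,\cdot)$ extends continuously to $\overline{\mathcal U}$; a graph limit $\Gamma$ is determined by the numbers $t(F,\Gamma)$, $F$ ranging over all graphs; and a sequence $G_n$ in $\overline{\mathcal U}$ converges to $\Gamma\in\mathcal U_\infty$ iff $v(G_n)\to\infty$ and $t(F,G_n)\to t(F,\Gamma)$ for every graph $F$. (Concretely, graph limits can be identified with the families $(t_F)_F$ arising as $t_F=\lim_n t(F,G_n)$ for sequences of graphs with $v(G_n)\to\infty$ for which all these limits exist.) Connectedness of graph limits. For $\Gamma_1,\Gamma_2\in\mathcal U_\infty$ and $\alpha\in[0,1]$, $\alpha\Gamma_1\oplus(1-\alpha)\Gamma_2$ is the unique graph limit $\Gamma$ with $t(F,\Gamma)=\alpha^{v(F)}t(F,\Gamma_1)+(1-\alpha)^{v(F)}t(F,\Gamma_2)$ for every connected graph $F$. A graph limit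 $\Gamma$ is disconnected if there exist $\Gamma_1,\Gamma_2\in\mathcal U_\infty$ and $\alpha\in(0,1)$ with $\Gamma=\alpha\Gamma_1\oplus(1-\alpha)\Gamma_2$; otherwise it is connected. Kernels. A kernel on a probability space $(\mathcal S,\mu)$ is a symmetric measurable function $W:\mathcal S\times\mathcal S\to[0,1]$. It represents the unique graph limit $\Gamma_W$ satisfying $t(F,\Gamma_W)=\int_{\mathcal S^{v(F)}}\prod_{ij\in E(F)}W(x_i,x_j)\,d\mu(x_1)\cdots d\mu(x_{v(F)})$ for every graph $F$ (with vertices labelled $1,\dots,v(F)$). A kernel $W$ is disconnected if either $W=0$ a.e. on $\mathcal S\times\mathcal S$, or there exists a measurable $A\subset\mathcal S$ with $0<\mu(A)<1$ such that $W=0$ a.e. on $A\times(\mathcal S\setminus A)$; otherwise $W$ is connected. *)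

(* Defs.v *)
From HB Require Import structures.
From mathcomp Require Import all_boot all_order all_algebra.
From mathcomp Require Import all_classical all_reals all_analysis.

Set Implicit Arguments.
Unset Strict Implicit.
Unset Printing Implicit Defensive.

Import Order.TTheory GRing.Theory Num.Theory.
Import numFieldNormedType.Exports.

Local Open Scope classical_set_scope.
Local Open Scope ring_scope.

(* Labelled representatives: every finite graph is isomorphic to one on 'I_n. *)
Record sgraph := SGraph {
  nverts : nat;
  nverts_gt0 : (0 < nverts)%N;
  adj : rel 'I_nverts;
  adj_sym : symmetric adj;
  adj_irr : irreflexive adj }.

Definition graph_connected (F : sgraph) : bool :=
  [forall x, forall y, connect (@adj F) x y].

Definition is_hom (F G : sgraph) (f : {ffun 'I_(nverts F) -> 'I_(nverts G)}) :
    bool :=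
  [forall x, forall y, adj x y ==> adj (f x) (f y)].

Definition hom_density (R : realType) (F G : sgraph) : R :=
  #|[set f | @is_hom F G f]%SET|%:R
    / #|{: {ffun 'I_(nverts F) -> 'I_(nverts G)}}|%:R.

(* A graph limit is identified with its family of densities t(F, Gamma), F
   ranging over all graphs. *)
Record graph_limit (R : realType) := GraphLimit {
  limit_density : sgraph -> R;
  limit_densityP : exists G_ : nat -> sgraph,
    nverts (G_ n) @[n --> \oo] --> \oo /\
    forall F, hom_density R F (G_ n) @[n --> \oo] --> limit_density F }.

(* Gamma = alpha Gamma1 (+) (1 - alpha) Gamma2.  The densities of connected
   graphs determine a graph limit, because t(., Gamma) is multiplicative over
   disjoint unions. *)
Definition is_direct_sum (R : realType) (alpha : R)
    (Gamma1 Gamma2 Gamma : graph_limit R) : Prop :=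
  forall F, graph_connected F ->
    limit_density Gamma F = alpha ^+ nverts F * limit_density Gamma1 F
      + (1 - alpha) ^+ nverts F * limit_density Gamma2 F.

Definition limit_disconnected (R : realType) (Gamma : graph_limit R) : Prop :=
  exists (Gamma1 Gamma2 : graph_limit R) (alpha : R),
    0 < alpha < 1 /\ is_direct_sum alpha Gamma1 Gamma2 Gamma.

Definition limit_connected (R : realType) (Gamma : graph_limit R) : Prop :=
  ~ limit_disconnected Gamma.

Definition is_kernel d (S : measurableType d) (R : realType) (W : S * S -> R) :
    Prop :=
  [/\ measurable_fun setT W,
      forall x y, W (x, y) = W (y, x) &
      forall z, 0 <= W z <= 1].

(* The integral of f over S^n, as \int dmu(x_1) ... \int dmu(x_n); for
   nonnegative measurable f it agrees with the integral against the product
   measure by Tonelli's theorem. *)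
Fixpoint iter_integral d (S : measurableType d) (R : realType)
    (mu : probability S R) (n : nat) : (n.-tuple S -> \bar R) -> \bar R :=
  match n with
  | 0 => fun f => f [tuple]
  | m.+1 => fun f =>
      (\int[mu]_x iter_integral mu (fun t : m.-tuple S => f [tuple of x :: t]))%E
  end.

(* Each edge {i, j} is counted once, as the pair with i < j. *)
Definition kernel_density d (S : measurableType d) (R : realType)
    (mu : probability S R) (W : S * S -> R) (F : sgraph) : \bar R :=
  iter_integral mu (fun x : (nverts F).-tuple S =>
    (\prod_(p : 'I_(nverts F) * 'I_(nverts F) | (p.1 < p.2)%N && adj p.1 p.2)
       W (tnth x p.1, tnth x p.2))%:E).

Definition represents d (S : measurableType d) (R : realType)
    (mu : probability S R) (W : S * S -> R) (Gamma : graph_limit R) : Prop :=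
  forall F, (limit_density Gamma F)%:E = kernel_density mu W F.

Definition kernel_disconnected d (S : measurableType d) (R : realType)
    (mu : probability S R) (W : S * S -> R) : Prop :=
  {ae (mu \x mu)%E, forall z, W z = 0} \/
  exists A : set S,
    [/\ measurable A, (0 < mu A)%E, (mu A < 1)%E &
        {ae (mu \x mu)%E, forall z, (A `*` ~` A) z -> W z = 0}].

Definition kernel_connected d (S : measurableType d) (R : realType)
    (mu : probability S R) (W : S * S -> R) : Prop :=
  ~ kernel_disconnected mu W.

(* Main.v *)
Require Import Defs.
From HB Require Import structures.
From mathcomp Require Import all_boot all_order all_algebra.
From mathcomp Require Import all_classical all_reals all_analysis.
From mathcomp Require Import measurable_realfun ring lra.

Set Implicit Arguments.
Unset Strict Implicit.
Unset Printing Implicit Defensive.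

Import Order.TTheory GRing.Theory Num.Theory.
Import numFieldNormedType.Exports.

(** Write t(F; mu, W) for the density of F in the kernel W on the probability
    space (S, mu).

    A cut of W gives a cut of the limit.  If W vanishes between A and its
    complement B, then in a copy of a connected F with nonzero weight all
    vertices are in A or all are in B, so that
      t(F; mu, W) = mu(A)^v(F) t(F; mu_A, W) + mu(B)^v(F) t(F; mu_B, W)
    with mu_A and mu_B the conditional measures ([kernel_density_mix]).  The
    two kernels on the right have to represent graph limits, that is, families
    of densities of actual graph sequences.  This is [kernel_represents]: in
    the W-random graph on n vertices the density of F has mean t(F) + O(1/n),
    and since t(F u F) = t(F)^2 for the disjoint union, its variance is also
    O(1/n); so some graph on n vertices has nearly the right density for any
    given finite set of graphs F.  If W = 0 almost everywhere, the limit is the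
    sum of two copies of itself.

    A cut of the limit gives a cut of W.  Two independent random vertices x, y
    can only be joined by a path if they are in the same part.  Let P_k(x, y)
    be the density of paths with k inner vertices from x to y, and consider
      Phi_l(W) = int int prod_(k in l) (1 - P_k(x, y)) dx dy
    for a list l of positive integers.  Expanding the product and replacing
    each P_k by an integral over inner vertices of its own, Phi_l is a signed
    sum of densities t(F; mu, W), F running through unions of internally
    disjoint paths between two terminals; these F are simple graphs because
    every path has an inner vertex.  Let Gamma = a Gamma_1 + (1 - a) Gamma_2
    with H_j -> Gamma_1 and K_j -> Gamma_2.  The disjoint union of H_j and K_j,
    with total vertex weights a and 1 - a, is a kernel on a finite subset of
    nat whose densities converge to those of W, first for connected F and then
    for all F by multiplicativity over components ([cvg_density_of_connected]).
    For this kernel P_k(x, y) = 0 whenever x is in the first part and y in the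
    second, so Phi_l >= a (1 - a), and the bound passes to W ([path_density_lb]).
    Letting l contain each of 1, ..., m with multiplicity m -> oo, the
    integrand tends to the indicator of the set of pairs with P_k(x, y) = 0
    for all k > 0, which therefore has measure at least a (1 - a) > 0
    ([unlinked_lb]).  But if W is connected that set is null
    ([connected_unlinked0]): otherwise, for some x, the set B of all y that no
    path links to x has positive measure, and W vanishes between B and its
    complement because P_(k+1)(x, y) = int W(y, z) P_k(x, z) dz. *)

Local Open Scope classical_set_scope.
Local Open Scope ring_scope.

(** * Iterated integrals *)

Lemma emeasurable_sum_cond d (T : measurableType d) (R : realType)
    (I : Type) (s : seq I) (P : pred I) (f : I -> T -> \bar R) :
  (forall i, measurable_fun setT (f i)) ->
  measurable_fun setT (fun x => \sum_(i <- s | P i) f i x)%E.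
Proof.
move=> mf; elim: s => [|i s IH].
  by rewrite (_ : (fun _ => _) = cst 0%E) //; apply/funext => x; rewrite big_nil.
rewrite (_ : (fun _ => _) = (fun x => if P i
    then f i x + \sum_(k <- s | P k) f k x
    else \sum_(k <- s | P k) f k x)%E).
  by case: (P i) => //; exact: emeasurable_funD.
by apply/funext => x; rewrite big_cons.
Qed.

Section IterIntegral.
Context d (S : measurableType d) (R : realType).
Implicit Types mu nu : probability S R.
Local Open Scope ereal_scope.

Definition comap k n (phi : 'I_k -> 'I_n) (x : n.-tuple S) : k.-tuple S :=
  [tuple tnth x (phi i) | i < k].

Lemma tnth_comap k n (phi : 'I_k -> 'I_n) x i :
  tnth (comap phi x) i = tnth x (phi i).
Proof. exact: tnth_mktuple. Qed.

Lemma measurable_comap k n (phi : 'I_k -> 'I_n) :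
  measurable_fun [set: n.-tuple S] (comap phi).
Proof.
apply/measurable_fun_tnthP => i.
rewrite (_ : _ \o _ = (@tnth _ S)^~ (phi i)); first exact: measurable_tnth.
by apply/funext => x /=; rewrite tnth_comap.
Qed.

Lemma measurable_cons_pair d' (T : measurableType d') n
    (f : T * n.+1.-tuple S -> \bar R) :
  measurable_fun setT f ->
  measurable_fun setT
    (fun z : (T * S) * n.-tuple S => f (z.1.1, [tuple of z.1.2 :: z.2])).
Proof.
move=> mf; apply: (measurableT_comp mf).
apply: measurable_fun_pair.
  exact: (measurableT_comp measurable_fst measurable_fst).
apply: measurable_cons => //.
exact: (measurableT_comp measurable_snd measurable_fst).
Qed.

Lemma iter_integralS mu n (f : n.+1.-tuple S -> \bar R) :
  iter_integral mu f =
  \int[mu]_x iter_integral mu (fun t : n.-tuple S => f [tuple of x :: t]).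
Proof. by []. Qed.

Lemma iter_integral_ge0 mu n (f : n.-tuple S -> \bar R) :
  (forall x, 0 <= f x) -> 0 <= iter_integral mu f.
Proof.
elim: n f => [|n IH] f f0 /=; first exact: f0.
by apply: integral_ge0 => x _; apply: IH.
Qed.

Lemma measurable_iter_integral_param mu n d' (T : measurableType d')
    (f : T * n.-tuple S -> \bar R) :
  measurable_fun setT f -> (forall z, 0 <= f z) ->
  measurable_fun setT (fun y => iter_integral mu (fun t => f (y, t))).
Proof.
elim: n d' T f => [|n IH] d' T f mf f0 /=.
  by apply: (measurableT_comp mf); apply: measurable_fun_pair.
pose g z := iter_integral mu (fun t : n.-tuple S => f (z.1, [tuple of z.2 :: t])).
apply: (@measurable_fun_fubini_tonelli_F _ _ T S R mu g).
  apply: (IH _ _ (fun z : (T * S) * n.-tuple S => f (z.1.1, [tuple of z.1.2 :: z.2]))) => //.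
  exact: measurable_cons_pair.
by move=> z; apply: iter_integral_ge0.
Qed.

Lemma measurable_iter_integral_cons mu n (f : n.+1.-tuple S -> \bar R) :
  measurable_fun setT f -> (forall z, 0 <= f z) ->
  measurable_fun setT
    (fun x => iter_integral mu (fun t : n.-tuple S => f [tuple of x :: t])).
Proof.
move=> mf f0.
apply: (@measurable_iter_integral_param mu n _ S (fun z => f [tuple of z.1 :: z.2])) => //.
by apply: (measurableT_comp mf); exact: measurable_cons.
Qed.

Lemma measurable_section_cons n (f : n.+1.-tuple S -> \bar R) x :
  measurable_fun setT f ->
  measurable_fun setT (fun t : n.-tuple S => f [tuple of x :: t]).
Proof.
by move=> mf; apply: (measurableT_comp mf); exact: measurable_cons.
Qed.

Lemma iter_integralD mu n (f g : n.-tuple S -> \bar R) :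
  measurable_fun setT f -> (forall x, 0 <= f x) ->
  measurable_fun setT g -> (forall x, 0 <= g x) ->
  iter_integral mu (fun x => f x + g x) = iter_integral mu f + iter_integral mu g.
Proof.
elim: n f g => [|n IH] f g mf f0 mg g0 //=.
rewrite -ge0_integralD //; first last.
- exact: measurable_iter_integral_cons.
- by move=> x _; apply: iter_integral_ge0.
- exact: measurable_iter_integral_cons.
- by move=> x _; apply: iter_integral_ge0.
by apply: eq_integral => x _; rewrite IH //; exact: measurable_section_cons.
Qed.

Lemma iter_integralZl mu n (c : \bar R) (f : n.-tuple S -> \bar R) :
  0 <= c -> measurable_fun setT f -> (forall x, 0 <= f x) ->
  iter_integral mu (fun x => c * f x) = c * iter_integral mu f.
Proof.
move=> c0; elim: n f => [|n IH] f mf f0 //=.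
rewrite -ge0_integralZl //; first last.
- by move=> x _; apply: iter_integral_ge0.
- exact: measurable_iter_integral_cons.
by apply: eq_integral => x _; rewrite IH //; exact: measurable_section_cons.
Qed.

Lemma le_iter_integral mu n (f g : n.-tuple S -> \bar R) :
  measurable_fun setT f -> (forall x, 0 <= f x) ->
  measurable_fun setT g -> (forall x, f x <= g x) ->
  iter_integral mu f <= iter_integral mu g.
Proof.
elim: n f g => [|n IH] f g mf f0 mg fg //=.
have g0 x : 0 <= g x by apply: le_trans (fg x).
apply: ge0_le_integral => //.
- by move=> x _; apply: iter_integral_ge0.
- exact: measurable_iter_integral_cons.
- exact: measurable_iter_integral_cons.
- by move=> x _; apply: IH => //; exact: measurable_section_cons.
Qed.

Lemma iter_integral_cst mu n (c : \bar R) :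
  iter_integral mu (fun _ : n.-tuple S => c) = c.
Proof.
elim: n => [|n IH] //=.
rewrite IH -[RHS]mule1 -(probability_setT mu).
exact: (integral_cst mu measurableT).
Qed.

Lemma iter_integral_sum mu n (I : Type) (s : seq I) (P : pred I)
    (f : I -> n.-tuple S -> \bar R) :
  (forall i, measurable_fun [set: n.-tuple S] (f i)) -> (forall i x, 0 <= f i x) ->
  iter_integral mu (fun x => \sum_(i <- s | P i) f i x)
    = \sum_(i <- s | P i) iter_integral mu (f i).
Proof.
move=> mf f0; elim: s => [|i s IH].
  rewrite big_nil -[RHS](iter_integral_cst mu n 0); congr iter_integral.
  by apply/funext => x; rewrite big_nil.
rewrite big_cons -IH; case: ifPn => Pi.
  rewrite -iter_integralD //.
  - by congr iter_integral; apply/funext => x; rewrite big_cons Pi.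
  - exact: emeasurable_sum_cond.
  - by move=> x; apply: sume_ge0.
by congr iter_integral; apply/funext => x; rewrite big_cons (negbTE Pi).
Qed.

Definition insert_coord n (i : 'I_n.+1) (x : S) (t : n.-tuple S) :
    n.+1.-tuple S :=
  [tuple if unlift i j is Some k then tnth t k else x | j < n.+1].

Lemma insert_coord0 n x (t : n.-tuple S) :
  insert_coord ord0 x t = [tuple of x :: t].
Proof.
apply: eq_from_tnth => j; rewrite tnth_mktuple.
case: unliftP => [k ->|->]; last by rewrite tnth0.
by rewrite tnthS.
Qed.

Lemma insert_coordS n (i : 'I_n.+1) x y (t : n.-tuple S) :
  insert_coord (lift ord0 i) x [tuple of y :: t] =
  [tuple of y :: insert_coord i x t].
Proof.
apply: eq_from_tnth => j; rewrite tnth_mktuple.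
case: (unliftP ord0 j) => [j' ->|->]; last first.
  rewrite tnth0.
  case: unliftP => [k|] E; last by move/(congr1 val): E.
  have -> : k = ord0 :> 'I_n.+1.
    apply/val_inj; move/(congr1 val): E => /=; rewrite /bump.
    by case: (val k) => // m; rewrite addnS.
  exact: tnth0.
rewrite tnthS tnth_mktuple.
case: (unliftP i j') => [k ->|->].
  have -> : lift ord0 (lift i k) = lift (lift ord0 i) (lift ord0 k).
    by apply/val_inj; rewrite /= /bump /= !add1n ltnS addnS.
  by rewrite liftK tnthS.
by rewrite unlift_none.
Qed.

Lemma measurable_insert_coord n (i : 'I_n.+1) :
  measurable_fun setT
    (fun z : S * n.-tuple S => insert_coord i z.1 z.2).
Proof.
apply/measurable_fun_tnthP => j.
case E: (unlift i j) => [k|].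
  rewrite (_ : _ \o _ = (fun z : S * n.-tuple S => tnth z.2 k)); last first.
    by apply/funext => z /=; rewrite tnth_mktuple E.
  exact: (measurableT_comp (measurable_tnth k) measurable_snd).
rewrite (_ : _ \o _ = (fun z : S * n.-tuple S => z.1)).
  exact: measurable_fst.
by apply/funext => z /=; rewrite tnth_mktuple E.
Qed.

(** By Tonelli, any coordinate may be integrated last.  This is the only form in
    which the symmetry of the iterated integral enters: invariance under
    permutations and marginalization both follow from it. *)
Lemma iter_integral_pull mu n (i : 'I_n.+1) (f : n.+1.-tuple S -> \bar R) :
  measurable_fun setT f -> (forall x, 0 <= f x) ->
  iter_integral mu f =
  \int[mu]_x iter_integral mu (fun t => f (insert_coord i x t)).
Proof.
elim: n i f => [|n IH] i f mf f0.
  have -> : i = ord0 by apply/val_inj; case: i => -[].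
  by rewrite /=; apply: eq_integral => x _; rewrite insert_coord0.
case: (unliftP ord0 i) => [i' ->|->]; last first.
  rewrite iter_integralS; apply: eq_integral => x _.
  by congr iter_integral; apply/funext => t; rewrite insert_coord0.
rewrite iter_integralS.
transitivity (\int[mu]_y \int[mu]_x
   iter_integral mu (fun t : n.-tuple S =>
     f [tuple of y :: insert_coord i' x t])).
  apply: eq_integral => y _; rewrite (IH i') //.
  exact: measurable_section_cons.
rewrite (fubini_tonelli (fun z : S * S => iter_integral mu (fun t : n.-tuple S =>
     f [tuple of z.1 :: insert_coord i' z.2 t]))).
- apply: eq_integral => x _ /=; apply: eq_integral => y _.
  by congr iter_integral; apply/funext => t; rewrite insert_coordS.
- apply: (@measurable_iter_integral_param mu n _ _
    (fun z : (S * S) * n.-tuple S =>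
       f [tuple of z.1.1 :: insert_coord i' z.1.2 z.2])) => //.
  apply: (measurableT_comp mf); apply: measurable_cons.
    exact: (measurableT_comp measurable_fst measurable_fst).
  apply: (@measurableT_comp _ _ _ _ _ _
    (fun z : S * n.-tuple S => insert_coord i' z.1 z.2) _
    (fun z : (S * S) * n.-tuple S => (z.1.2, z.2))).
    exact: measurable_insert_coord.
  apply: measurable_fun_pair => //.
  exact: (measurableT_comp measurable_snd measurable_fst).
- by move=> z; apply: iter_integral_ge0.
Qed.

(** Induction on [k], pulling out the coordinate [phi ord0].  Coordinates outside
    the range of [phi] remain at the end, where a constant is integrated. *)
Lemma iter_integral_marginal mu k n (phi : 'I_k -> 'I_n)
    (f : k.-tuple S -> \bar R) :
  injective phi -> measurable_fun setT f -> (forall x, 0 <= f x) ->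
  iter_integral mu (fun t => f (comap phi t)) = iter_integral mu f.
Proof.
elim: k n phi f => [|k IH] n phi f phiI mf f0 /=.
  rewrite -[RHS](iter_integral_cst mu n); congr iter_integral.
  by apply/funext => t; rewrite [comap phi t]tuple0.
case: n phi phiI => [phi|n phi phiI]; first by case: (phi ord0).
have ne i : phi ord0 != phi (lift ord0 i).
  by apply/negP => /eqP/phiI.
pose psi i := s2val (unlift_some (ne i)).
have psiE i : phi (lift ord0 i) = lift (phi ord0) (psi i).
  exact: (s2valP (unlift_some (ne i))).
rewrite (iter_integral_pull mu (phi ord0)) //; last first.
  by apply: (measurableT_comp mf); exact: measurable_comap.
apply: eq_integral => x _.
rewrite -(IH n psi) //.
- congr iter_integral; apply/funext => t; congr f.
  apply: eq_from_tnth => j; rewrite tnth_comap tnth_mktuple.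
  case: (unliftP ord0 j) => [j' ->|->].
    by rewrite psiE liftK tnthS tnth_comap.
  by rewrite unlift_none tnth0.
- by move=> i j e; apply: (@lift_inj _ ord0); apply: phiI; rewrite !psiE e.
- exact: measurable_section_cons.
Qed.

Lemma iter_integral_pair mu n (i j : 'I_n) (h : S * S -> \bar R) :
  measurable_fun setT h -> (forall z, 0 <= h z) -> i != j ->
  iter_integral mu (fun x : n.-tuple S => h (tnth x i, tnth x j))
  = \int[mu]_x \int[mu]_y h (x, y).
Proof.
move=> mh h0 ij.
pose phi (k : 'I_2) := if k == ord0 then i else j.
have phiI : injective phi.
  move=> [[|[|//]] ?] [[|[|//]] ?] //=; rewrite /phi /= => e; try exact/val_inj.
    by move: ij; rewrite e eqxx.
  by move: ij; rewrite e eqxx.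
pose f (t : 2.-tuple S) := h (tnth t ord0, tnth t ord_max).
transitivity (iter_integral mu (fun x => f (comap phi x))).
  by congr iter_integral; apply/funext => x; rewrite /f !tnth_comap.
rewrite (iter_integral_marginal mu (f := f)) //; last by move=> x; exact: h0.
by apply: (measurableT_comp mh); apply: measurable_fun_pair; exact: measurable_tnth.
Qed.

Lemma iter_integralM mu k l (f : k.-tuple S -> \bar R) (g : l.-tuple S -> \bar R) :
  measurable_fun setT f -> (forall x, 0 <= f x) ->
  measurable_fun setT g -> (forall x, 0 <= g x) ->
  iter_integral mu (fun t : (k + l).-tuple S =>
     f (comap (@lshift k l) t) * g (comap (@rshift k l) t))
  = iter_integral mu f * iter_integral mu g.
Proof.
move=> + + mg g0; elim: k f => [|k IH] f mf f0.
  rewrite -[iter_integral mu f]/(f [tuple]) -iter_integralZl //.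
  congr iter_integral; apply/funext => t; congr (f _ * g _).
    by rewrite [LHS]tuple0.
  apply: eq_from_tnth => j; rewrite tnth_comap; congr tnth; exact: val_inj.
rewrite [iter_integral mu f]iter_integralS -ge0_integralZr //; first last.
- exact: iter_integral_ge0.
- by move=> x _; apply: iter_integral_ge0.
- exact: measurable_iter_integral_cons.
rewrite iter_integralS; apply: eq_integral => x _.
rewrite -IH //; last exact: measurable_section_cons.
congr iter_integral; apply/funext => t.
have E i : lshift l (lift ord0 i) = lift ord0 (lshift l i) by apply/val_inj.
have E' i : rshift k.+1 i = lift ord0 (rshift k i) :> 'I_(k.+1 + l) by apply/val_inj.
congr (f _ * g _).
  apply: eq_from_tnth => j; rewrite tnth_comap.
  case: (unliftP ord0 j) => [j' ->|->].
    by rewrite E !tnthS tnth_comap.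
  by rewrite tnth0 (_ : lshift l ord0 = ord0) ?tnth0 //; apply/val_inj.
by apply: eq_from_tnth => j; rewrite !tnth_comap E' tnthS.
Qed.

(** The hypothesis says that [mu] restricted to [A] is [c] times [nu]; applied in
    each of the [n] coordinates it yields the factor [c ^+ n]. *)
Lemma iter_integral_restrict mu nu (A : set S) (c : R) n
    (f : n.-tuple S -> \bar R) :
  measurable A -> (0 <= c)%R ->
  (forall g : S -> \bar R, measurable_fun setT g -> (forall x, 0 <= g x) ->
     \int[mu]_x ((\1_A x)%:E * g x) = c%:E * \int[nu]_x g x) ->
  measurable_fun setT f -> (forall x, 0 <= f x) ->
  iter_integral mu (fun x => (\prod_i \1_A (tnth x i))%R%:E * f x)
  = (c ^+ n)%:E * iter_integral nu f.
Proof.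
move=> mA c0 muA; elim: n f => [|n IH] f mf f0.
  by rewrite /= big_ord0 expr0.
rewrite iter_integralS exprS EFinM -muleA [iter_integral nu f]iter_integralS.
rewrite -ge0_integralZl //; first last.
- by rewrite lee_fin exprn_ge0.
- by move=> x _; apply: iter_integral_ge0.
- exact: measurable_iter_integral_cons.
rewrite -muA; first last.
- by move=> x; rewrite mule_ge0 ?lee_fin ?exprn_ge0 ?iter_integral_ge0.
- apply: emeasurable_funM => //; exact: measurable_iter_integral_cons.
apply: eq_integral => x _.
rewrite -IH //; last exact: measurable_section_cons.
have mp m : measurable_fun setT (fun t : m.-tuple S => (\prod_i \1_A (tnth t i))%R%:E : \bar R).
  apply/measurable_EFinP; apply: measurable_prod => i _.
  by apply: measurableT_comp (measurable_tnth i); exact: measurable_indic.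
have p0 m (t : m.-tuple S) : 0 <= (\prod_i \1_A (tnth t i))%R%:E :> \bar R.
  by rewrite lee_fin; apply: prodr_ge0 => i _; rewrite indicE.
rewrite -iter_integralZl //.
- congr iter_integral; apply/funext => t.
  rewrite big_ord_recl tnth0 EFinM -muleA; congr (_ * (_ * _)).
  by congr EFin; apply: eq_bigr => i _; rewrite tnthS.
- apply: emeasurable_funM; first exact: mp.
  exact: measurable_section_cons.
- by move=> t; rewrite mule_ge0.
Qed.

End IterIntegral.

(** * Edge products and densities of unions *)

(** The first edge of a path that leaves [P]. *)
Lemma connect_crossing (T : finType) (e : rel T) (P : pred T) x y :
  connect e x y -> P x -> ~~ P y -> exists a b, [/\ e a b, P a & ~~ P b].
Proof.
move=> /connectP[p + ->]; elim: p x => [|z p IH] x /=; first by move=> _ ->.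
move=> /andP[exz pz] Px Py; have [Pz|nPz] := boolP (P z); first exact: (IH z).
by exists x, z.
Qed.

Lemma measurable_prod_cond d (T : measurableType d) (R : realType)
    (I : Type) (s : seq I) (P : pred I) (h : I -> T -> R) :
  (forall i, measurable_fun setT (h i)) ->
  measurable_fun setT (fun x => \prod_(i <- s | P i) h i x).
Proof.
move=> mh; elim: s => [|i s IH].
  by rewrite (_ : (fun _ => _) = cst 1) //; apply/funext => x; rewrite big_nil.
rewrite (_ : (fun _ => _) = (fun x => if P i
    then h i x * \prod_(k <- s | P k) h k x else \prod_(k <- s | P k) h k x)).
  by case: (P i) => //; exact: measurable_funM.
by apply/funext => x; rewrite big_cons.
Qed.

Section EdgeProduct.
Context d (S : measurableType d) (R : realType).
Variable W : S * S -> R.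
Hypothesis kW : is_kernel W.

Let measW : measurable_fun setT W. Proof. by case: kW. Qed.
Let symW x y : W (x, y) = W (y, x). Proof. by case: kW. Qed.
Let W01 z : 0 <= W z <= 1. Proof. by case: kW. Qed.
Let W0 z : 0 <= W z. Proof. by case/andP: (W01 z). Qed.

Definition edge_product (F : sgraph) (x : (nverts F).-tuple S) : R :=
  \prod_(p : 'I_(nverts F) * 'I_(nverts F) | (p.1 < p.2)%N && adj p.1 p.2)
    W (tnth x p.1, tnth x p.2).

Lemma kernel_densityE (mu : probability S R) F :
  kernel_density mu W F = iter_integral mu (fun x => (@edge_product F x)%:E).
Proof. by []. Qed.

Lemma edge_product_ge0 F x : 0 <= @edge_product F x.
Proof. exact: prodr_ge0. Qed.

Lemma edge_product_le1 F x : @edge_product F x <= 1.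
Proof. exact: prodr_ile1. Qed.

Lemma measurable_edge n (i j : 'I_n) :
  measurable_fun setT (fun x : n.-tuple S => W (tnth x i, tnth x j)).
Proof.
apply: (measurableT_comp measW); apply: measurable_fun_pair;
  exact: measurable_tnth.
Qed.

Lemma measurable_edge_product F : measurable_fun setT (@edge_product F).
Proof.
by apply: measurable_prod_cond => p; exact: measurable_edge.
Qed.

Lemma measurable_edge_productE F :
  measurable_fun setT (fun x => (@edge_product F x)%:E).
Proof. by apply/measurable_EFinP; exact: measurable_edge_product. Qed.

(** The square is a product over ordered adjacent pairs, so it does not depend on
    the order of the vertices.  Identities between edge products under
    relabelling are proved by comparing squares of nonnegative numbers. *)
Lemma edge_product_sqr F x :
  @edge_product F x ^+ 2 =
  \prod_(p : 'I_(nverts F) * 'I_(nverts F) | adj p.1 p.2)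
    W (tnth x p.1, tnth x p.2).
Proof.
rewrite [RHS](bigID (fun p : 'I_(nverts F) * 'I_(nverts F) => p.1 < p.2)%N) /= expr2.
congr (_ * _).
  by apply: eq_bigl => p; rewrite andbC.
rewrite [RHS](reindex_inj
  (h := fun p : 'I_(nverts F) * 'I_(nverts F) => (p.2, p.1))) /=; last first.
  by move=> [a b] [a' b'] /= [-> ->].
apply: eq_big => [p|p _]; last exact: symW.
rewrite -leqNgt adj_sym andbC [(p.1 <= p.2)%N]leq_eqVlt.
by case: eqP => [e|] //=; rewrite (val_inj e : p.1 = p.2) adj_irr.
Qed.

Lemma edge_product_le_edge F x a b : adj a b ->
  @edge_product F x <= W (tnth x a, tnth x b).
Proof.
have key (p q : 'I_(nverts F)) : (p < q)%N -> adj p q ->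
    @edge_product F x <= W (tnth x p, tnth x q).
  move=> pq apq; rewrite /edge_product (bigD1 (p, q)) /= ?pq //.
  by rewrite ler_piMr// prodr_ile1.
move=> ab; have [lt|gt|e] := ltngtP a b; first exact: key.
- by rewrite symW; apply: key => //; rewrite adj_sym.
- by move: ab; rewrite (val_inj e) adj_irr.
Qed.

Variable mu : probability S R.

Lemma kernel_density_ge0 F : (0 <= kernel_density mu W F)%E.
Proof. by apply: iter_integral_ge0 => x; rewrite lee_fin edge_product_ge0. Qed.

Lemma kernel_density_le1 F : (kernel_density mu W F <= 1)%E.
Proof.
rewrite -(iter_integral_cst mu (nverts F) 1%E) kernel_densityE.
apply: le_iter_integral => //; first exact: measurable_edge_productE.
- by move=> x; rewrite lee_fin edge_product_ge0.
- by move=> x; rewrite lee_fin edge_product_le1.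
Qed.

Lemma kernel_density_fin_num F : kernel_density mu W F \is a fin_num.
Proof.
rewrite ge0_fin_numE ?kernel_density_ge0 //.
exact: le_lt_trans (kernel_density_le1 F) (ltry 1).
Qed.

Lemma kernel_density_marginal n F (phi : 'I_(nverts F) -> 'I_n) :
  injective phi ->
  iter_integral mu (fun x : n.-tuple S => (edge_product (comap phi x))%:E)
  = kernel_density mu W F.
Proof.
move=> phiI; rewrite (@iter_integral_marginal _ _ _ _ _ _ _
  (fun x => (@edge_product F x)%:E)) //; first exact: measurable_edge_productE.
by move=> x; rewrite lee_fin edge_product_ge0.
Qed.

(** Pulled back along [h], the edge product of [F] splits into factors that depend
    on disjoint sets of coordinates, and the integral of such a product is the
    product of the integrals. *)
Lemma kernel_density_union (F F1 F2 : sgraph)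
    (h : 'I_(nverts F1 + nverts F2) -> 'I_(nverts F)) :
  bijective h ->
  (forall i j, adj (h (lshift _ i)) (h (lshift _ j)) = adj i j) ->
  (forall i j, adj (h (rshift _ i)) (h (rshift _ j)) = adj i j) ->
  (forall i j, adj (h (lshift _ i)) (h (rshift _ j)) = false) ->
  (kernel_density mu W F = kernel_density mu W F1 * kernel_density mu W F2)%E.
Proof.
move=> hB adjl adjr adjlr.
have hI := bij_inj hB.
pose f (t : (nverts F1 + nverts F2).-tuple S) :=
  ((edge_product (comap (@lshift _ _) t))%:E *
   (edge_product (comap (@rshift _ _) t))%:E)%E.
rewrite !kernel_densityE -iter_integralM; first last.
- by move=> x; rewrite lee_fin edge_product_ge0.
- exact: measurable_edge_productE.
- by move=> x; rewrite lee_fin edge_product_ge0.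
- exact: measurable_edge_productE.
rewrite -(iter_integral_marginal mu hI (f := f)); first last.
- by move=> x; rewrite mule_ge0 ?lee_fin ?edge_product_ge0.
- apply: emeasurable_funM.
    apply: (measurableT_comp (f := fun x => (@edge_product F1 x)%:E)).
      exact: measurable_edge_productE.
    exact: measurable_comap.
  apply: (measurableT_comp (f := fun x => (@edge_product F2 x)%:E)).
    exact: measurable_edge_productE.
  exact: measurable_comap.
congr iter_integral; apply/funext => x; rewrite /f -EFinM; congr EFin.
apply/eqP; rewrite -(@eqrXn2 _ 2) ?edge_product_ge0 ?mulr_ge0 ?edge_product_ge0 //.
rewrite exprMn !edge_product_sqr; apply/eqP.
have pair n (P : rel 'I_n) G :
    \prod_(p : 'I_n * 'I_n | P p.1 p.2) G p.1 p.2 =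
    \prod_i \prod_(j | P i j) G i j :> R by rewrite pair_big_dep.
rewrite (pair _ (@adj F) (fun p q => W (tnth x p, tnth x q))).
rewrite (pair _ (@adj F1) (fun p q => W (tnth (comap _ (comap h x)) p,
   tnth (comap _ (comap h x)) q))).
rewrite (pair _ (@adj F2) (fun p q => W (tnth (comap _ (comap h x)) p,
   tnth (comap _ (comap h x)) q))).
rewrite (reindex h) /=; last exact: onW_bij.
rewrite big_split_ord /=; congr (_ * _); apply: eq_bigr => i _.
  rewrite (reindex h) /=; last exact: onW_bij.
  rewrite big_split_ord /= [X in _ * X]big_pred0 ?mulr1; last by move=> j; rewrite adjlr.
  by apply: eq_big => [j|j _]; rewrite ?adjl // !tnth_comap.
rewrite (reindex h) /=; last exact: onW_bij.
rewrite big_split_ord /= big_pred0 ?mul1r; last by move=> j; rewrite adj_sym adjlr.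
by apply: eq_big => [j|j _]; rewrite ?adjr // !tnth_comap.
Qed.

Definition cut_integrand (A : set S) (z : S * S) : R :=
  \1_A z.1 * W z * \1_(~` A) z.2.

Lemma cut_integrand_ge0 A z : 0 <= cut_integrand A z.
Proof. by rewrite !mulr_ge0 ?indicE. Qed.

Lemma measurable_cut_integrand A : measurable A ->
  measurable_fun setT (cut_integrand A).
Proof.
move=> mA; apply: measurable_funM; first apply: measurable_funM => //.
- apply: (measurableT_comp (f := (\1_A : S -> R))); first exact: measurable_indic.
  exact: measurable_fst.
- apply: (measurableT_comp (f := (\1_(~` A) : S -> R))); last exact: measurable_snd.
  by apply: measurable_indic; exact: measurableC.
Qed.

Definition cut_mass (A : set S) : \bar R :=
  (\int[mu]_x \int[mu]_y (cut_integrand A (x, y))%:E)%E.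

(** Tonelli turns the almost everywhere condition into the vanishing of an
    iterated integral, the form that the density computations use. *)
Lemma cut_mass_eq0 A : measurable A ->
  cut_mass A = 0%E <->
  {ae (mu \x mu)%E, forall z, (A `*` ~` A) z -> W z = 0}.
Proof.
move=> mA.
have mc : measurable_fun setT (EFin \o cut_integrand A).
  by apply/measurable_EFinP; exact: measurable_cut_integrand.
have -> : cut_mass A = (\int[mu \x mu]_z `|(cut_integrand A z)%:E|)%E.
  rewrite /cut_mass.
  under [RHS]eq_integral do rewrite gee0_abs ?lee_fin ?cut_integrand_ge0 //.
  rewrite (fubini_tonelli1 (EFin \o cut_integrand A)) //.
  by move=> z; rewrite lee_fin cut_integrand_ge0.
rewrite ae_eq_integral_abs //; split; apply: filterS => z.
  move=> /(_ I)[/eqP]; rewrite /cut_integrand !mulf_eq0 !indicE.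
  move=> + [Az1 Az2]; rewrite !mem_set // oner_eq0 orbF /=.
  by move/eqP.
move=> Wz _; congr EFin; rewrite /cut_integrand !indicE.
case: (boolP (z.1 \in A)) => [/set_mem zA|_]; last by rewrite !mul0r.
case: (boolP (z.2 \in ~` A)) => [/set_mem zA'|_]; last by rewrite mulr0.
by rewrite Wz // mulr0 mul0r.
Qed.

End EdgeProduct.

(** * Densities across a cut *)

Section Mixture.
Context d (S : measurableType d) (R : realType).
Variable W : S * S -> R.
Hypothesis kW : is_kernel W.
Variables (mu mu1 mu2 : probability S R) (A : set S) (a b : R).
Hypotheses (mA : measurable A) (a0 : 0 <= a) (b0 : 0 <= b).
Hypothesis muA : forall g : S -> \bar R, measurable_fun setT g ->
  (forall x, 0 <= g x)%E ->
  (\int[mu]_x ((\1_A x)%:E * g x) = a%:E * \int[mu1]_x g x)%E.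
Hypothesis muB : forall g : S -> \bar R, measurable_fun setT g ->
  (forall x, 0 <= g x)%E ->
  (\int[mu]_x ((\1_(~` A) x)%:E * g x) = b%:E * \int[mu2]_x g x)%E.
Hypothesis cut0 : cut_mass W mu A = 0%E.

Lemma measurable_prod_indic n (B : set S) : measurable B ->
  measurable_fun setT (fun x : n.-tuple S => \prod_i \1_B (tnth x i) : R).
Proof.
move=> mB; apply: measurable_prod_cond => i.
apply: (measurableT_comp (f := (\1_B : S -> R))); first exact: measurable_indic.
exact: measurable_tnth.
Qed.

(** Up to an error bounded by the total mass of the edges from [A] to its
    complement, only maps with all vertices in [A], or all in the complement,
    contribute: a connected graph with vertices on both sides has a crossing
    edge.  The error is an integral of a sum of terms each equal to
    [cut_mass W mu A]. *)
Lemma kernel_density_mix F : graph_connected F ->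
  (kernel_density mu W F = (a ^+ nverts F)%:E * kernel_density mu1 W F
    + (b ^+ nverts F)%:E * kernel_density mu2 W F)%E.
Proof.
move=> cF.
have mB : measurable (~` A) by exact: measurableC.
pose e := @edge_product _ S R W F.
pose pr B (x : (nverts F).-tuple S) : R := \prod_i \1_B (tnth x i).
have e0 x : 0 <= e x by exact: edge_product_ge0.
have pr0 B x : 0 <= pr B x by apply: prodr_ge0 => i _; rewrite indicE.
have me : measurable_fun setT (EFin \o e) by exact: measurable_edge_productE.
rewrite !kernel_densityE.
rewrite -(iter_integral_restrict mA a0 muA) //.
rewrite -(iter_integral_restrict mB b0 muB) //.
(* The contribution of the maps with vertices on both sides of the cut. *)
pose rest x := e x * (1 - pr A x - pr (~` A) x).
have pr1 x : pr A x + pr (~` A) x <= 1.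
  have bound B : pr B x <= \1_B (tnth x (Ordinal (nverts_gt0 F))).
    rewrite /pr (bigD1 (Ordinal (nverts_gt0 F))) //= ler_piMr ?indicE //.
    by apply: prodr_ile1 => i _; rewrite indicE; case: (_ \in _); rewrite ?lexx ?ler01.
  apply: le_trans (lerD (bound A) (bound (~` A))) _.
  by rewrite !indicE in_setC; case: (_ \in _); rewrite /= ?addr0 ?add0r.
have rest0 x : 0 <= rest x by rewrite mulr_ge0 // -addrA -opprD subr_ge0.
have mpr B : measurable B -> measurable_fun setT (pr B) by exact: measurable_prod_indic.
have mrest : measurable_fun setT (EFin \o rest).
  apply/measurable_EFinP; apply: measurable_funM; first exact: measurable_edge_product.
  by apply: measurable_funB; [apply: measurable_funB|]; try exact: mpr.
have mM B : measurable B -> measurable_fun setT (fun x => ((pr B x)%:E * (e x)%:E)%E).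
  by move=> mB'; apply: emeasurable_funM => //; apply/measurable_EFinP; exact: mpr.
have M0 B x : (0 <= (pr B x)%:E * (e x)%:E)%E by rewrite mule_ge0 ?lee_fin.
transitivity (iter_integral mu (fun x =>
    ((pr A x)%:E * (e x)%:E + (pr (~` A) x)%:E * (e x)%:E) + (rest x)%:E)%E).
  congr iter_integral; apply/funext => x; rewrite -!EFinM -!EFinD; congr EFin.
  by rewrite /rest -/(e x); ring.
rewrite iter_integralD //; first last.
- by move=> x; rewrite adde_ge0.
- by apply: emeasurable_funD; exact: mM.
rewrite iter_integralD //; try exact: mM.
suff -> : iter_integral mu (EFin \o rest) = 0%E by rewrite adde0.
apply/eqP; rewrite eq_le iter_integral_ge0 ?andbT; last by move=> x; rewrite /= lee_fin.
pose c (p : 'I_(nverts F) * 'I_(nverts F)) (x : (nverts F).-tuple S) : \bar R :=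
  (cut_integrand W A (tnth x p.1, tnth x p.2))%:E.
have c0 p x : (0 <= c p x)%E by rewrite lee_fin cut_integrand_ge0.
have mcut : measurable_fun setT (EFin \o cut_integrand W A).
  by apply/measurable_EFinP; exact: measurable_cut_integrand.
have mc p : measurable_fun setT (c p).
  by apply: (measurableT_comp mcut); apply: measurable_fun_pair;
    exact: measurable_tnth.
apply: (@le_trans _ _ (iter_integral mu (fun x => \sum_(p | adj p.1 p.2) c p x)%E)).
  apply: le_iter_integral => //.
  - exact: emeasurable_sum_cond.
  - move=> x; rewrite -[(EFin \o rest) x]/((rest x)%:E).
    have [[i iA]|noA] := pselect (exists i, A (tnth x i)); last first.
      have -> : rest x = 0 - e x * pr A x.
        rewrite /rest (_ : pr (~` A) x = 1); first by ring.
        rewrite /pr big1 // => i _; rewrite indicE mem_set // => Ai.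
        by apply: noA; exists i.
      apply: (@le_trans _ _ 0%E); last exact: sume_ge0.
      by rewrite lee_fin sub0r oppr_le0 mulr_ge0.
    have [[j jA]|allA] := pselect (exists j, ~ A (tnth x j)); last first.
      have -> : rest x = 0 - e x * pr (~` A) x.
        rewrite /rest (_ : pr A x = 1); first by ring.
        rewrite /pr big1 // => j _; rewrite indicE mem_set //.
        by apply: contrapT => Aj; apply: allA; exists j.
      apply: (@le_trans _ _ 0%E); last exact: sume_ge0.
      by rewrite lee_fin sub0r oppr_le0 mulr_ge0.
    have cij : connect (@adj F) i j by move/forallP: cF => /(_ i)/forallP.
    have [||p [q [pq /asboolP Ap /asboolP Aq]]] :=
      @connect_crossing _ _ (fun i => `[< A (tnth x i) >]) _ _ cij.
    - exact/asboolP.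
    - exact/asboolP.
    rewrite (bigD1 (p, q)) //=.
    apply: (@le_trans _ _ (c (p, q) x)); last by rewrite leeDl // sume_ge0.
    rewrite lee_fin /cut_integrand /= !indicE !mem_set // mul1r mulr1.
    apply: le_trans (edge_product_le_edge kW x pq).
    by rewrite /rest ler_piMr // -addrA -opprD gerBl addr_ge0.
rewrite iter_integral_sum // big1 // => p adjp.
rewrite (iter_integral_pair _ mcut) //.
  by move=> z; rewrite lee_fin cut_integrand_ge0.
apply/negP => /eqP e12.
by move: adjp; rewrite e12 adj_irr.
Qed.

End Mixture.

(** * Conditional and atomic probability measures *)

Section NewProbabilities.
Context d (S : measurableType d) (R : realType).
Local Open Scope ereal_scope.

Lemma integral_mnormalize (m : {measure set S -> \bar R}) (P : probability S R)
    (c : R) (g : S -> \bar R) :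
  (0 < c)%R -> m setT = c%:E -> measurable_fun setT g -> (forall x, 0 <= g x) ->
  \int[mnormalize m P]_x g x = (c^-1)%:E * \int[m]_x g x.
Proof.
move=> c0 mT mg g0.
have ic0 : (0 <= c^-1)%R by rewrite invr_ge0 ltW.
rewrite -[RHS](@ge0_integral_mscale _ _ _ m setT _ (NngNum ic0)) //.
apply: eq_measure_integral => B mB _.
rewrite [LHS]/= /mnormalize mT eqe (gt_eqF c0) /=.
by rewrite /mscale /= muleC.
Qed.

Lemma integral_mrestr (mu : {measure set S -> \bar R}) (A : set S)
    (mA : measurable A) (g : S -> \bar R) :
  measurable_fun setT g -> (forall x, 0 <= g x) ->
  \int[mrestr mu mA]_x g x = \int[mu]_x ((\1_A x)%:E * g x).
Proof.
move=> mg g0.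
have mA' := measurableC mA.
have -> : \int[mrestr mu mA]_x g x =
    \int[mrestr mu mA]_(x in A) g x + \int[mrestr mu mA]_(x in ~` A) g x.
  rewrite -(ge0_integral_setU _ mA mA') ?setUv //.
  exact/disj_setPCl.
rewrite [X in _ + X](eq_measure_integral mzero); last first.
  move=> B mB BA; rewrite /= /mrestr /mzero (_ : B `&` A = set0) ?measure0 //.
  by apply/seteqP; split => // x [/BA].
rewrite integral_measure_zero adde0.
rewrite [LHS](eq_measure_integral mu); last first.
  by move=> B mB BA; rewrite /= /mrestr setIidl.
rewrite integral_mkcond; apply: eq_integral => x _.
by rewrite patchE indicE; case: (x \in A); rewrite ?mul1e ?mul0e.
Qed.

(** The normalized restriction of [mu] to [A]. *)
Lemma conditional_probability (mu : probability S R) (A : set S) :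
  measurable A -> 0 < mu A ->
  exists nu : probability S R, forall g : S -> \bar R,
    measurable_fun setT g -> (forall x, 0 <= g x) ->
    \int[mu]_x ((\1_A x)%:E * g x) = (fine (mu A))%:E * \int[nu]_x g x.
Proof.
move=> mA A0; exists (mnormalize (mrestr mu mA) mu) => g mg g0.
have Af : mu A \is a fin_num by rewrite fin_num_measure.
have c0 : (0 < fine (mu A))%R by rewrite fine_gt0 // A0 ltey_eq Af.
rewrite (integral_mnormalize _ c0) //; last by rewrite /= /mrestr setTI fineK.
by rewrite integral_mrestr // muleA -EFinM divff ?mul1e // gt_eqF.
Qed.

Lemma atomic_probability N (w : 'I_N -> R) (iota : 'I_N -> S) :
  (forall i, 0 <= w i)%R -> (\sum_i w i = 1)%R ->
  exists nu : probability S R, forall g : S -> \bar R,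
    measurable_fun setT g -> (forall x, 0 <= g x) ->
    \int[nu]_x g x = \sum_(i < N) (w i)%:E * g (iota i).
Proof.
move=> w0 w1.
case: N w iota w0 w1 => [w iota _|N w iota w0 w1].
  by rewrite big_ord0 => /esym/eqP; rewrite oner_eq0.
pose m (i : nat) := mscale (NngNum (w0 (inord i))) (dirac (iota (inord i))) : {measure set S -> \bar R}.
exists (mnormalize (msum m N.+1) (dirac (iota ord0))) => g mg g0.
rewrite (integral_mnormalize _ ltr01) //; last first.
  rewrite /= /msum -w1 -sumEFin; apply: eq_bigr => i _.
  by rewrite /m /= /mscale /= diracT mule1 inord_val.
rewrite invr1 mul1e ge0_integral_measure_sum //.
apply: eq_bigr => i _; rewrite /m ge0_integral_mscale // integral_dirac //.
by rewrite diracT mul1e inord_val.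
Qed.

Lemma iter_integral_uniform (nu : probability S R) N (iota : 'I_N -> S) (c : R) n
    (f : n.-tuple S -> \bar R) :
  (0 <= c)%R ->
  (forall g : S -> \bar R, measurable_fun setT g -> (forall x, 0 <= g x) ->
    \int[nu]_x g x = \sum_(i < N) c%:E * g (iota i)) ->
  measurable_fun setT f -> (forall x, 0 <= f x) ->
  iter_integral nu f =
  \sum_(x : {ffun 'I_n -> 'I_N}) (c ^+ n)%:E * f [tuple iota (x i) | i < n].
Proof.
move=> c0 nuE; elim: n f => [|n IH] f mf f0.
  rewrite (bigD1 (ffun0 (card_ord 0))) //=.
  rewrite big_pred0 ?adde0.
    by rewrite expr0 mul1e; congr f; rewrite [RHS]tuple0.
  by move=> x; apply/negbTE/negPn/eqP/ffunP => -[].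
rewrite iter_integralS nuE; last by move=> x; apply: iter_integral_ge0.
  pose h (p : 'I_N * {ffun 'I_n -> 'I_N}) : {ffun 'I_n.+1 -> 'I_N} :=
    [ffun j => if unlift ord0 j is Some k then p.2 k else p.1].
  rewrite [RHS](reindex h) /=; last first.
    exists (fun x : {ffun 'I_n.+1 -> 'I_N} => (x ord0, [ffun k => x (lift ord0 k)])).
      move=> [i x] _ /=; rewrite ffunE unlift_none; congr (_, _).
      by apply/ffunP => k; rewrite !ffunE liftK.
    move=> x _; apply/ffunP => j; rewrite ffunE.
    by case: unliftP => [k ->|->] /=; rewrite ?ffunE.
  rewrite -(pair_bigA _ (fun i x => (c ^+ n.+1)%:E * f [tuple iota (h (i, x) j) | j < n.+1])) /=.
  apply: eq_bigr => i _; rewrite IH //; last exact: measurable_section_cons.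
  rewrite ge0_sume_distrr; last by move=> x _; rewrite mule_ge0 ?lee_fin ?exprn_ge0.
  apply: eq_bigr => x _; rewrite muleA -EFinM -exprS; congr (_ * f _).
  apply: eq_from_tnth => j; rewrite tnth_mktuple /h ffunE.
  case: unliftP => [k ->|->] /=; last by rewrite tnth0.
  by rewrite tnthS tnth_mktuple.
exact: measurable_iter_integral_cons.
Qed.

(** A homomorphism density is the kernel density for the uniform measure on the
    vertices, placed in [S] by [iota].  Since [iota] and [W] are arbitrary, this
    serves a graph alone as well as a graph inside a larger kernel. *)
Lemma hom_density_kernel (nu : probability S R) (W : S * S -> R) (G F : sgraph)
    (iota : 'I_(nverts G) -> S) :
  is_kernel W ->
  (forall i j, W (iota i, iota j) = (adj i j)%:R%R) ->
  (forall g : S -> \bar R, measurable_fun setT g -> (forall x, 0 <= g x) ->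
    \int[nu]_x g x = \sum_(i < nverts G) ((nverts G)%:R^-1)%:E * g (iota i)) ->
  kernel_density nu W F = (hom_density R F G)%:E.
Proof.
move=> kW WG nuE; rewrite kernel_densityE.
rewrite (iter_integral_uniform _ nuE) ?invr_ge0 ?ler0n //; first last.
- by move=> x; rewrite lee_fin edge_product_ge0.
- exact: measurable_edge_productE.
under eq_bigr do rewrite -EFinM.
rewrite sumEFin; congr EFin; rewrite -mulr_sumr mulrC /hom_density.
rewrite card_ffun !card_ord natrX exprVn; congr (_ / _)%R.
rewrite -sum1_card natr_sum [RHS]big_mkcond; apply: eq_bigr => x _; rewrite inE.
have sq := edge_product_sqr kW [tuple iota (x i) | i < nverts F].
apply/eqP; rewrite -(@eqrXn2 _ 2) ?edge_product_ge0 ?sq //; last by case: ifP.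
under eq_bigr do rewrite !tnth_mktuple WG.
case: ifPn => [/forallP xh|].
  rewrite big1 ?expr1n // => p adjp.
  by move/forallP: (xh p.1) => /(_ p.2)/implyP/(_ adjp) ->.
rewrite negb_forall => /existsP[i]; rewrite negb_forall => /existsP[j].
rewrite negb_imply => /andP[aij naij].
by rewrite (bigD1 (i, j)) //= (negbTE naij) mul0r expr0n.
Qed.

End NewProbabilities.

(** * Finite graphs as kernels on the natural numbers *)

Lemma nat_pair_measurable (A : set (nat * nat)) : measurable A.
Proof.
rewrite (_ : A = \bigcup_i \bigcup_j (if `[< A (i, j) >] then [set i] `*` [set j] else set0)).
  apply: bigcup_measurable => i _; apply: bigcup_measurable => j _.
  by case: asboolP => // _; exact: measurableX.
apply/seteqP; split => [[i j] Aij|[i j]].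
  by exists i => //; exists j => //; rewrite asboolT.
by case=> a _ [b _]; case: asboolP => // Aab [/= -> ->].
Qed.

Lemma measurable_nat_pair (R : realType) (f : nat * nat -> R) : measurable_fun setT f.
Proof. by move=> _ B mB; exact: nat_pair_measurable. Qed.

Definition nat_adj (G : sgraph) : rel nat := fun a b =>
  if (insub a, insub b) is (Some i, Some j) then @adj G i j else false.

Definition nat_kernel (R : realType) (G : sgraph) (z : nat * nat) : R :=
  (nat_adj G z.1 z.2)%:R.

Lemma nat_kernelP (R : realType) G : is_kernel (nat_kernel R G).
Proof.
split; first exact: measurable_nat_pair.
- move=> x y; rewrite /nat_kernel /nat_adj /=; congr (nat_of_bool _)%:R.
  by case: insubP => [i|] _; case: insubP => [j|] //= _ _; rewrite adj_sym.
have bool01 (b : bool) : 0 <= (b%:R : R) <= 1 by case: b; rewrite ?lexx ler01.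
by move=> z; exact: bool01.
Qed.

Lemma nat_kernelE (R : realType) G (i j : 'I_(nverts G)) :
  nat_kernel R G (val i, val j) = (adj i j)%:R.
Proof. by rewrite /nat_kernel /nat_adj /= !valK. Qed.

Lemma hom_density_as_kernel (R : realType) (G : sgraph) :
  exists nu : probability nat R, forall F,
    kernel_density nu (nat_kernel R G) F = (hom_density R F G)%:E.
Proof.
have N0 : (nverts G)%:R != 0 :> R by rewrite pnatr_eq0 -lt0n nverts_gt0.
have [||nu nuE] := @atomic_probability _ nat R (nverts G) (fun=> (nverts G)%:R^-1) val.
- by move=> i; rewrite invr_ge0 ler0n.
- by rewrite sumr_const card_ord -[X in X = 1]mulr_natr mulVf.
exists nu => F; apply: (hom_density_kernel F (nat_kernelP R G) (@nat_kernelE R G)).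
exact: nuE.
Qed.

Section Union.
Variables F1 F2 : sgraph.

Definition union_adj : rel 'I_(nverts F1 + nverts F2) := fun i j =>
  match fintype.split i, fintype.split j with
  | inl i', inl j' => adj i' j'
  | inr i', inr j' => adj i' j'
  | _, _ => false
  end.

Lemma union_adj_sym : symmetric union_adj.
Proof.
by move=> i j; rewrite /union_adj; case: fintype.split => i'; case: fintype.split => j' //;
  rewrite adj_sym.
Qed.

Lemma union_adj_irr : irreflexive union_adj.
Proof. by move=> i; rewrite /union_adj; case: fintype.split => i'; rewrite adj_irr. Qed.

Lemma union_nverts_gt0 : (0 < nverts F1 + nverts F2)%N.
Proof. by rewrite addn_gt0 nverts_gt0. Qed.

Definition sgraph_union := SGraph union_nverts_gt0 union_adj_sym union_adj_irr.

Lemma split_lshift n m (i : 'I_n) : fintype.split (lshift m i) = inl i.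
Proof. exact: (unsplitK (inl i)). Qed.

Lemma split_rshift n m (i : 'I_n) : fintype.split (rshift m i) = inr i.
Proof. exact: (unsplitK (inr i)). Qed.

Lemma kernel_density_sgraph_union d (S : measurableType d) (R : realType)
    (mu : probability S R) W : is_kernel W ->
  (kernel_density mu W sgraph_union
     = kernel_density mu W F1 * kernel_density mu W F2)%E.
Proof.
move=> kW; apply: (@kernel_density_union _ _ _ _ kW _ sgraph_union F1 F2 id).
- by exists id.
- by move=> i j; rewrite /= /union_adj !split_lshift.
- by move=> i j; rewrite /= /union_adj !split_rshift.
- by move=> i j; rewrite /= /union_adj split_lshift split_rshift.
Qed.

End Union.

Lemma hom_density_union (R : realType) (F1 F2 G : sgraph) :
  hom_density R (sgraph_union F1 F2) G = hom_density R F1 G * hom_density R F2 G.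
Proof.
have [nu nuE] := hom_density_as_kernel R G.
suff : (hom_density R (sgraph_union F1 F2) G)%:E =
    (hom_density R F1 G * hom_density R F2 G)%:E by move=> [].
rewrite -nuE [RHS]EFinM -!nuE.
by apply: kernel_density_sgraph_union; exact: nat_kernelP.
Qed.

(** * Random graphs sampled from a kernel *)

Section SetGraph.
Variable n : nat.
Implicit Type A : {set 'I_n.+1 * 'I_n.+1}.

(** Only the pairs [(i, j)] of [A] with [i < j] count as edges, so every set of
    pairs is a sample point; this keeps the sum over samples a sum over all
    sets. *)
Definition set_adj A : rel 'I_n.+1 := fun i j =>
  ((i < j)%N && ((i, j) \in A)) || ((j < i)%N && ((j, i) \in A)).

Lemma set_adj_sym A : symmetric (set_adj A).
Proof. by move=> i j; rewrite /set_adj orbC. Qed.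

Lemma set_adj_irr A : irreflexive (set_adj A).
Proof. by move=> i; rewrite /set_adj ltnn. Qed.

Definition set_graph A := SGraph (ltn0Sn n) (set_adj_sym A) (set_adj_irr A).

(** The normal form of an edge, which fixes the variable it has in the sample. *)
Definition sort_pair (e : 'I_n.+1 * 'I_n.+1) : 'I_n.+1 * 'I_n.+1 :=
  if (e.1 < e.2)%N then e else (e.2, e.1).

Lemma set_adjE A i j : i != j -> set_adj A i j = (sort_pair (i, j) \in A).
Proof.
move=> ij; rewrite /set_adj /sort_pair /=; case: ltngtP => //= [_|/ord_inj e].
  by rewrite orbF.
by rewrite e eqxx in ij.
Qed.

Variables (F : sgraph) (h : {ffun 'I_(nverts F) -> 'I_n.+1}).
Hypothesis hI : injective h.

Definition edges : {set 'I_(nverts F) * 'I_(nverts F)} :=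
  [set p : 'I_(nverts F) * 'I_(nverts F) | (p.1 < p.2)%N && adj p.1 p.2]%SET.

Definition edge_image : {set 'I_n.+1 * 'I_n.+1} :=
  [set sort_pair (h p.1, h p.2) | p in edges]%SET.

Lemma sort_pair_inj :
  {in edges &, injective (fun p => sort_pair (h p.1, h p.2))}.
Proof.
move=> [p1 p2] [q1 q2]; rewrite !inE /= => /andP[p12 _] /andP[q12 _].
rewrite /sort_pair /=.
by case: ifP => _; case: ifP => _ [/hI e1 /hI e2]; move: p12 q12;
  rewrite e1 e2 //; case: ltngtP.
Qed.

Lemma is_hom_set_graph A : is_hom (G := set_graph A) h = (edge_image \subset A).
Proof.
apply/idP/idP => [/forallP hh|/fintype.subsetP sub].
  apply/fintype.subsetP => _ /imsetP[[p q] /[!inE] /= /andP[pq apq] ->].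
  rewrite -set_adjE; last by rewrite (inj_eq hI) neq_ltn pq.
  by move/forallP: (hh p) => /(_ q)/implyP; apply.
have key (p q : 'I_(nverts F)) : (p < q)%N -> adj p q -> set_adj A (h p) (h q).
  move=> pq apq; rewrite set_adjE; last by rewrite (inj_eq hI) neq_ltn pq.
  by apply: sub; apply/imsetP; exists (p, q); rewrite // inE /= pq.
apply/forallP => p; apply/forallP => q; apply/implyP => apq.
have [pq|qp|/ord_inj e] := ltngtP p q; first exact: key.
- by rewrite adj_sym; apply: key; rewrite // adj_sym.
- by move: apq; rewrite e adj_irr.
Qed.

End SetGraph.

(** The proportion of injective maps from [v] to [N] points is at least
    [1 - v ^ 2 / N]. *)
Lemma ffact_ratio (R : realType) (N v : nat) : (0 < N)%N ->
  1 - (v ^ 2)%:R / N%:R <= (N ^_ v)%:R / (N ^ v)%:R :> R.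
Proof.
move=> N0; have N0' : 0 < N%:R :> R by rewrite ltr0n.
elim: v => [|v IH].
  by rewrite ffactn0 expn0 divr1 mul0r subr0.
rewrite ffactnSr [(N ^ v.+1)%N]expnSr.
rewrite [(N ^_ v * _)%:R]natrM [(N ^ v * _)%:R]natrM invfM mulrACA.
set r := (X in _ <= X * _); rewrite -/r in IH.
have r1 : 0 <= r <= 1.
  rewrite divr_ge0 ?ler0n //= ler_pdivrMr ?ltr0n ?expn_gt0 ?N0 // mul1r ler_nat.
  elim: (v) => [|k IHk]; first by rewrite ffactn0.
  by rewrite ffactnSr expnSr leq_mul // leq_subr.
have sub : 1 - v%:R / N%:R <= (N - v)%:R / N%:R :> R.
  have -> : 1 - v%:R / N%:R = (N%:R - v%:R) / N%:R :> R.
    by field; rewrite gt_eqF.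
  rewrite ler_pM2r ?invr_gt0 // lerBlDr -natrD ler_nat; by rewrite addnC -leq_subLR.
have q0 : 0 <= v%:R / N%:R :> R by rewrite divr_ge0.
apply: (@le_trans _ _ (r * (1 - v%:R / N%:R))); last first.
  by rewrite ler_wpM2l //; case/andP: r1.
have -> : (v.+1 ^ 2)%:R / N%:R = (v ^ 2)%:R / N%:R + 2 * (v%:R / N%:R) + N%:R^-1 :> R.
  rewrite -[v.+1]addn1 sqrnD !natrD natrM; ring.
have : 0 <= N%:R^-1 :> R by rewrite invr_ge0 ltW.
move: q0 r1 IH; set q := v%:R / N%:R; set z := _ / _; nra.
Qed.

Section Sampling.
Context d (S : measurableType d) (R : realType).
Variables (mu : probability S R) (W : S * S -> R).
Hypothesis kW : is_kernel W.

Let measW : measurable_fun setT W. Proof. by case: kW. Qed.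
Let symW x y : W (x, y) = W (y, x). Proof. by case: kW. Qed.
Let W01 z : 0 <= W z <= 1. Proof. by case: kW. Qed.
Let W0 z : 0 <= W z. Proof. by case/andP: (W01 z). Qed.

Definition density F : R := fine (kernel_density mu W F).

Lemma densityE F : (density F)%:E = kernel_density mu W F.
Proof. by rewrite fineK // kernel_density_fin_num. Qed.

Lemma density01 F : 0 <= density F <= 1.
Proof.
by rewrite -!lee_fin densityE kernel_density_ge0 // kernel_density_le1.
Qed.

Section Fixed.
Variable n : nat.
Local Notation pairs := ('I_n.+1 * 'I_n.+1)%type.
Implicit Types A B : {set pairs}.

(** Given the sampled points [x], the pair [e] is put in the set independently
    with probability [W (x_e)]. *)
Definition sample_weight A (x : n.+1.-tuple S) : R :=
  \prod_(e : pairs) if e \in A then W (tnth x e.1, tnth x e.2)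
                    else 1 - W (tnth x e.1, tnth x e.2).

Lemma sample_weight_ge0 A x : 0 <= sample_weight A x.
Proof.
apply: prodr_ge0 => e _; case: ifP => _ //.
by rewrite subr_ge0; case/andP: (W01 (tnth x e.1, tnth x e.2)).
Qed.

Lemma measurable_sample_weight A : measurable_fun setT (sample_weight A).
Proof.
apply: measurable_prod_cond => e; case: (e \in A); first exact: measurable_edge.
by apply: measurable_funB => //; exact: measurable_edge.
Qed.

Definition sample_prob A : R :=
  fine (iter_integral mu (fun x => (sample_weight A x)%:E)).

(** Given the points, the pairs in [B] are all present with probability equal to
    the product of their weights: expand the product of the sums
    [w e + (e \notin B) * (1 - w e)]. *)
Lemma sum_sample_weight B x :
  \sum_(A : {set pairs} | B \subset A) sample_weight A x =
  \prod_(e in B) W (tnth x e.1, tnth x e.2).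
Proof.
pose w (e : pairs) := W (tnth x e.1, tnth x e.2).
transitivity (\prod_(e : pairs) (w e + if e \in B then 0 else 1 - w e)).
  rewrite bigA_distr big_mkcond; apply: eq_bigr => A _.
  case: ifPn => [/fintype.subsetP BA|/subsetPn[e eB eA]].
    apply: eq_bigr => e _; case: ifP => // eA; case: ifP => // /BA.
    by rewrite eA.
  by rewrite (bigD1 e) //= (negbTE eA) eB mul0r.
rewrite [RHS]big_mkcond; apply: eq_bigr => e _.
by case: ifP => _; rewrite ?addr0 // addrC subrK.
Qed.

Lemma sample_probE A :
  (sample_prob A)%:E = iter_integral mu (fun x => (sample_weight A x)%:E).
Proof.
have ge0 : (0 <= iter_integral mu (fun x => (sample_weight A x)%:E))%E.
  by apply: iter_integral_ge0 => x; rewrite lee_fin sample_weight_ge0.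
rewrite fineK // ge0_fin_numE //.
apply: (@le_lt_trans _ _ 1%E); last exact: ltry.
rewrite -(iter_integral_cst mu n.+1 1%E); apply: le_iter_integral => //.
- by apply/measurable_EFinP; exact: measurable_sample_weight.
- by move=> x; rewrite lee_fin sample_weight_ge0.
- move=> x; rewrite lee_fin; apply: prodr_ile1 => e _.
  by case: ifP => _ //; move: (W01 (tnth x e.1, tnth x e.2)); lra.
Qed.

Lemma sample_prob_ge0 A : 0 <= sample_prob A.
Proof.
rewrite -lee_fin sample_probE.
by apply: iter_integral_ge0 => x; rewrite lee_fin sample_weight_ge0.
Qed.

Lemma sum_sample_prob B :
  (\sum_(A : {set pairs} | B \subset A) sample_prob A)%:E =
  iter_integral mu (fun x => (\prod_(e in B) W (tnth x e.1, tnth x e.2))%:E).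
Proof.
rewrite -sumEFin; under eq_bigr do rewrite sample_probE.
rewrite -iter_integral_sum.
- congr iter_integral; apply/funext => x.
  by rewrite sumEFin sum_sample_weight.
- by move=> A; apply/measurable_EFinP; exact: measurable_sample_weight.
- by move=> A x; rewrite lee_fin sample_weight_ge0.
Qed.

Lemma sample_prob_total : \sum_(A : {set pairs}) sample_prob A = 1.
Proof.
have := sum_sample_prob finset.set0.
under eq_bigl do rewrite finset.sub0set.
rewrite (_ : (fun x => _) = fun=> 1%E) ?iter_integral_cst; first by case.
by apply/funext => x; rewrite big_set0.
Qed.

(** An injective map sends distinct edges of [F] to distinct pairs, and the images
    of the vertices are independent points with law [mu]. *)
Lemma sample_hom_inj F (h : {ffun 'I_(nverts F) -> 'I_n.+1}) : injective h ->
  \sum_(A : {set pairs}) sample_prob A * (is_hom (G := set_graph A) h)%:R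
  = density F.
Proof.
move=> hI; apply: EFin_inj; rewrite densityE.
rewrite -(kernel_density_marginal kW mu hI).
transitivity ((\sum_(A : {set pairs} | edge_image h \subset A) sample_prob A)%:E).
  congr EFin; rewrite [RHS]big_mkcond; apply: eq_bigr => A _.
  by rewrite is_hom_set_graph //; case: ifP => _; rewrite ?mulr1 ?mulr0.
rewrite sum_sample_prob; congr iter_integral; apply/funext => x; congr EFin.
rewrite big_imset /=; last exact: sort_pair_inj.
apply: eq_big => [p|[p q] _]; first by rewrite inE.
rewrite !tnth_comap /sort_pair /=; case: ifP => //= _; exact: symW.
Qed.

(** Injective maps contribute exactly [density F] by [sample_hom_inj], and the
    others are a small proportion of all maps. *)
Lemma sample_mean F :
  `|\sum_(A : {set pairs}) sample_prob A * hom_density R F (set_graph A) - density F|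
  <= (nverts F ^ 2)%:R / n.+1%:R.
Proof.
pose v := nverts F.
pose c (h : {ffun 'I_v -> 'I_n.+1}) : R :=
  \sum_(A : {set pairs}) sample_prob A * (is_hom (G := set_graph A) h)%:R.
have c01 h : 0 <= c h <= 1.
  apply/andP; split.
    by apply: sumr_ge0 => A _; rewrite mulr_ge0 ?sample_prob_ge0.
  rewrite -sample_prob_total; apply: ler_sum => A _.
  by rewrite ler_piMr ?sample_prob_ge0 //; case: is_hom; rewrite ?lexx ?ler01.
have N0 : 0 < (n.+1 ^ v)%:R :> R by rewrite ltr0n expn_gt0.
have E : \sum_(A : {set pairs}) sample_prob A * hom_density R F (set_graph A)
    = (\sum_h c h) / (n.+1 ^ v)%:R.
  rewrite /c exchange_big mulr_suml; apply: eq_bigr => A _.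
  rewrite /hom_density card_ffun !card_ord -mulr_sumr mulrA; congr (_ * _ / _).
  rewrite -sum1_card natr_sum big_mkcond; apply: eq_bigr => h _; rewrite inE.
  by case: is_hom.
rewrite E.
have -> : (\sum_h c h) / (n.+1 ^ v)%:R - density F
    = (\sum_(h : {ffun 'I_v -> 'I_n.+1} | ~~ injectiveb h) (c h - density F)) / (n.+1 ^ v)%:R.
  have K : \sum_(h : {ffun 'I_v -> 'I_n.+1}) density F = density F * (n.+1 ^ v)%:R.
    by rewrite sumr_const card_ffun !card_ord mulr_natr.
  have {1}-> : density F = (\sum_(h : {ffun 'I_v -> 'I_n.+1}) density F) / (n.+1 ^ v)%:R.
    by rewrite K mulfK // gt_eqF.
  rewrite -mulrBl -sumrB (bigID (fun h : {ffun 'I_v -> 'I_n.+1} => injectiveb h)) /=.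
  rewrite big1 ?add0r // => h /injectiveP hI.
  by rewrite /c sample_hom_inj // subrr.
rewrite normrM [X in _ * X]ger0_norm ?invr_ge0 ?(ltW N0) //.
apply: (@le_trans _ _
  (#|[set h : {ffun 'I_v -> 'I_n.+1} | ~~ injectiveb h]%SET|%:R / (n.+1 ^ v)%:R)).
  rewrite ler_pM2r ?invr_gt0 //; apply: le_trans (ler_norm_sum _ _ _) _.
  rewrite -sum1_card natr_sum.
  rewrite [leRHS](eq_bigl (fun h : {ffun 'I_v -> 'I_n.+1} => ~~ injectiveb h));
    last by move=> h; rewrite inE.
  apply: ler_sum => h _; move: (c01 h) (density01 F); rewrite ler_norml; lra.
have -> : #|[set h : {ffun 'I_v -> 'I_n.+1} | ~~ injectiveb h]%SET|%:R
    = (n.+1 ^ v)%:R - (n.+1 ^_ v)%:R :> R.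
  have := cardsC [set h : {ffun 'I_v -> 'I_n.+1} | injectiveb h]%SET.
  rewrite card_inj_ffuns card_ffun !card_ord => <-; rewrite natrD [X in X - _]addrC addrK.
  by congr (_ %:R); apply: eq_card => h; rewrite !inE.
have := ffact_ratio R v (ltn0Sn n).
by rewrite mulrBl divff ?gt_eqF // lerBlDr addrC -lerBlDr.
Qed.

(** Since [hom_density] is multiplicative on disjoint unions, the second moment
    for [F] is the first moment for [sgraph_union F F], so that [sample_mean]
    controls both. *)
Lemma sample_variance F :
  \sum_(A : {set pairs}) sample_prob A * (hom_density R F (set_graph A) - density F) ^+ 2
  <= 6 * (nverts F ^ 2)%:R / n.+1%:R.
Proof.
have m1 := sample_mean F; have m2 := sample_mean (sgraph_union F F).
have t2 : density (sgraph_union F F) = density F ^+ 2.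
  apply: EFin_inj; rewrite densityE kernel_density_sgraph_union // -!densityE.
  by rewrite expr2.
have -> : \sum_(A : {set pairs}) sample_prob A * (hom_density R F (set_graph A) - density F) ^+ 2
  = \sum_(A : {set pairs}) sample_prob A * hom_density R (sgraph_union F F) (set_graph A)
    - 2 * density F * (\sum_(A : {set pairs}) sample_prob A * hom_density R F (set_graph A))
    + density F ^+ 2.
  have -> : density F ^+ 2 = \sum_(A : {set pairs}) sample_prob A * density F ^+ 2.
    by rewrite -mulr_suml sample_prob_total mul1r.
  rewrite mulr_sumr -sumrB -big_split /=.
  by apply: eq_bigr => A _; rewrite hom_density_union; ring.
have v2 : ((nverts (sgraph_union F F)) ^ 2)%:R = 4 * (nverts F ^ 2)%:R :> R.
  by rewrite /= addnn -muln2 expnMn natrM mulrC.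
move: m1 m2 (density01 F); rewrite v2 t2 !ler_norml.
rewrite -!mulrA; set q := _ / _; set E1 := \sum_A _; set E2 := \sum_A _; nra.
Qed.

End Fixed.

(** The expected sum of the first [m] squared errors tends to [0] as the number
    of vertices grows; some sample does at least as well as the average. *)
Lemma sample_exists (F_ : nat -> sgraph) (m : nat) (eps : R) : 0 < eps ->
  exists G : sgraph, (m <= nverts G)%N /\
    forall i, (i < m)%N -> (hom_density R (F_ i) G - density (F_ i)) ^+ 2 < eps.
Proof.
move=> e0.
pose C : R := \sum_(i < m) 6 * (nverts (F_ i) ^ 2)%:R.
have C0 : 0 <= C by apply: sumr_ge0 => i _; rewrite mulr_ge0.
(* Large enough for C / (n + 1) < eps, with C the sum of the variance constants. *)
pose n := maxn m (Num.bound (C / eps)).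
have nC : C / n.+1%:R < eps.
  rewrite ltr_pdivrMr ?ltr0n // mulrC -ltr_pdivrMr //.
  apply: lt_le_trans (archi_boundP _) _; first by rewrite divr_ge0 // ltW.
  by rewrite ler_nat; apply: leq_trans (leqnSn _); exact: leq_maxr.
have [A PA] : exists A : {set 'I_n.+1 * 'I_n.+1},
    \sum_(i < m) (hom_density R (F_ i) (set_graph A) - density (F_ i)) ^+ 2 < eps.
  apply/not_existsP => noA; move: nC; apply/negP; rewrite -leNgt.
  apply: (@le_trans _ _ (\sum_(A : {set 'I_n.+1 * 'I_n.+1}) sample_prob A *
     \sum_(i < m) (hom_density R (F_ i) (set_graph A) - density (F_ i)) ^+ 2)).
    rewrite -[leLHS]mul1r -(sample_prob_total n) mulr_suml; apply: ler_sum => A _.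
    rewrite ler_wpM2l ?sample_prob_ge0 // leNgt; apply/negP; exact: noA.
  under eq_bigr do rewrite mulr_sumr.
  rewrite exchange_big /= /C mulr_suml; apply: ler_sum => i _.
  exact: sample_variance.
exists (set_graph A); split; first by apply: leqW; exact: leq_maxl.
move=> i im; apply: le_lt_trans PA.
rewrite (bigD1 (Ordinal im)) //= lerDl sumr_ge0 // => j _; exact: sqr_ge0.
Qed.

End Sampling.

Lemma sgraph_eq (F G : sgraph) (e : nverts F = nverts G) :
  (forall i j, @adj F i j = @adj G (cast_ord e i) (cast_ord e j)) -> F = G.
Proof.
case: F G e => [n n0 a asym airr] [n' n0' a' asym' airr'] /= e.
case: n' / e n0' a' asym' airr' => n0' a' asym' airr' aE.
have E : a = a'.
  by apply/funext => i; apply/funext => j; rewrite aE !cast_ord_id.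
case: a' / E asym' airr' {aE} => asym' airr'.
rewrite (Prop_irrelevance n0 n0') (Prop_irrelevance asym asym').
by rewrite (Prop_irrelevance airr airr').
Qed.

(** An enumeration of all graphs, along which a diagonal sequence is chosen. *)
Definition nth_graph (k : nat) : sgraph :=
  if (unpickle k : option {n : nat & {set 'I_n.+1 * 'I_n.+1}}) is Some (existT n A)
  then set_graph A else @set_graph 0 finset.set0.

Lemma nth_graph_surj F : exists k, nth_graph k = F.
Proof.
have F0 := nverts_gt0 F; have e : (nverts F).-1.+1 = nverts F by rewrite prednK.
pose A : {set 'I_(nverts F).-1.+1 * 'I_(nverts F).-1.+1} :=
  [set p | adj (cast_ord e p.1) (cast_ord e p.2)]%SET.
exists (pickle (existT (fun n => {set 'I_n.+1 * 'I_n.+1}) _ A)).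
rewrite /nth_graph pickleK; apply: (@sgraph_eq (set_graph A) F e) => i j /=.
rewrite /set_adj !inE /=; case: (ltngtP i j) => [|_|/ord_inj ->] /=.
- by rewrite orbF.
- by rewrite adj_sym.
- by rewrite adj_irr.
Qed.

(** Every kernel represents a graph limit: choose for each [m] a graph whose
    densities are close to the right ones for the first [m] graphs. *)
Lemma kernel_represents d (S : measurableType d) (R : realType)
    (mu : probability S R) (W : S * S -> R) : is_kernel W ->
  exists Gamma : graph_limit R, represents mu W Gamma.
Proof.
move=> kW.
have /choice[G GP] m : exists G : sgraph, (m <= nverts G)%N /\ forall i, (i < m)%N ->
    (hom_density R (nth_graph i) G - density mu W (nth_graph i)) ^+ 2 < m.+1%:R^-1.
  by apply: sample_exists => //; rewrite invr_gt0 ltr0n.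
have lim : exists G_ : nat -> sgraph, nverts (G_ n) @[n --> \oo] --> \oo /\
    forall F, hom_density R F (G_ n) @[n --> \oo] --> density mu W F.
  exists G; split.
    apply/cvgnyPge => m; near=> n.
    by apply: leq_trans (GP n).1; near: n; exact: nbhs_infty_ge.
  move=> F; have [k <-] := nth_graph_surj F.
  apply/cvgrPdist_lt => e e0.
  have e20 : 0 < e ^+ 2 by exact: exprn_gt0.
  near=> n.
  rewrite distrC -(ltr_pXn2r (n := 2)) ?nnegrE ?(ltW e0) //.
  rewrite real_normK ?num_real //.
  apply: lt_le_trans ((GP n).2 k _) _; first by near: n; exact: nbhs_infty_gt.
  by apply: ltW; near: n; exact: (near_infty_natSinv_lt (PosNum e20)).
exists (GraphLimit lim) => F; exact: densityE.
Unshelve. all: by end_near.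
Qed.

(** * A disconnected kernel represents a disconnected limit *)

Section KernelToLimit.
Context d (S : measurableType d) (R : realType).
Variables (mu : probability S R) (W : S * S -> R) (Gamma : graph_limit R).
Hypotheses (kW : is_kernel W) (rW : represents mu W Gamma).

(** A connected graph with at least two vertices has an edge, whose weight alone bounds the
    edge product. *)
Lemma kernel_density_ae0 F :
  {ae (mu \x mu)%E, forall z, W z = 0} -> graph_connected F ->
  (1 < nverts F)%N -> kernel_density mu W F = 0%E.
Proof.
move=> W0 /forallP cF F1.
have measW : measurable_fun setT W by case: kW.
have Wge0 z : 0 <= W z by case: kW => _ _ /(_ z)/andP[].
pose i := Ordinal (ltnW F1); pose j := Ordinal F1.
have cij : connect (@adj F) i j by move/forallP: (cF i) => /(_ j).
have [a [b [ab _ _]]] := connect_crossing cij (eqxx i) (isT : ~~ pred1 i j).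
apply/eqP; rewrite eq_le kernel_density_ge0 // andbT kernel_densityE.
have mW : measurable_fun setT (EFin \o W) by exact/measurable_EFinP.
apply: (@le_trans _ _ (iter_integral mu (fun x => (EFin \o W) (tnth x a, tnth x b)))).
  apply: le_iter_integral.
  - exact: measurable_edge_productE.
  - by move=> x; rewrite lee_fin edge_product_ge0.
  - by apply/measurable_EFinP; exact: measurable_edge.
  - by move=> x; rewrite lee_fin edge_product_le_edge.
have neq_ab : a != b by apply/negP => /eqP e; move: ab; rewrite e adj_irr.
have EW0 z : (0 <= (EFin \o W) z)%E by rewrite lee_fin.
rewrite (iter_integral_pair mu mW EW0 neq_ab).
rewrite -(fubini_tonelli1 (EFin \o W)) //.
rewrite (ae_eq_integral (cst 0%E)) ?integral0 //.
by apply: filterS W0 => z Wz _ /=; rewrite Wz.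
Qed.

(** If [W] is almost everywhere zero, the only connected graph of positive density
    is the single vertex, so that the limit is the sum of two copies of itself.
    Otherwise the summands are represented by [W] with the two conditional
    measures. *)
Lemma limit_disconnected_of_kernel :
  kernel_disconnected mu W -> limit_disconnected Gamma.
Proof.
case=> [W0|[A [mA A0 A1 WA]]].
  exists Gamma, Gamma, 2^-1; split; first by lra.
  move=> F cF; have [F1|F1] := ltnP 1 (nverts F).
    suff -> : limit_density Gamma F = 0 by rewrite !mulr0 addr0.
    by apply: EFin_inj; rewrite rW kernel_density_ae0.
  have -> : nverts F = 1%N.
    by apply/eqP; rewrite eqn_leq F1 nverts_gt0.
  by rewrite !expr1 -mulrDl addrC subrK mul1r.
have Af : mu A \is a fin_num by rewrite fin_num_measure.
pose a := fine (mu A); have aE : a%:E = mu A by rewrite fineK.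
have mB := measurableC mA.
have BE : mu (~` A) = (1 - a)%:E by rewrite probability_setC // -aE.
have a0 : 0 < a by rewrite -lte_fin aE.
have a1 : a < 1 by rewrite -lte_fin aE.
have [mu1 mu1E] := conditional_probability mA A0.
have [|mu2 mu2E] := conditional_probability mB (mu := mu).
  by rewrite BE lte_fin subr_gt0.
rewrite -/a in mu1E; rewrite BE /= in mu2E.
have [Gamma1 r1] := kernel_represents mu1 kW.
have [Gamma2 r2] := kernel_represents mu2 kW.
exists Gamma1, Gamma2, a; split; first by rewrite a0.
move=> F cF; apply: EFin_inj; rewrite EFinD !EFinM rW r1 r2.
apply: (kernel_density_mix kW mA _ _ mu1E mu2E) => //; first exact: ltW.
  by rewrite subr_ge0 ltW.
exact/(cut_mass_eq0 kW mu mA).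
Qed.

End KernelToLimit.

(** * Convergence of all densities from connected graphs *)

Section Induced.
Variables (F : sgraph) (C : {set 'I_(nverts F)}).
Hypothesis C0 : (0 < #|C|)%N.

Definition induced_adj : rel 'I_#|C| := fun i j => adj (enum_val i) (enum_val j).

Lemma induced_adj_sym : symmetric induced_adj.
Proof. by move=> i j; rewrite /induced_adj adj_sym. Qed.

Lemma induced_adj_irr : irreflexive induced_adj.
Proof. by move=> i; rewrite /induced_adj adj_irr. Qed.

Definition induced := SGraph C0 induced_adj_sym induced_adj_irr.
End Induced.

(** [F1] is the component of a vertex and [F2] is the rest. *)
Lemma disconnected_split (F : sgraph) : ~~ graph_connected F ->
  exists F1 F2 : sgraph, [/\ (nverts F1 < nverts F)%N, (nverts F2 < nverts F)%N &
    forall d (S : measurableType d) (R : realType) (mu : probability S R) W,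
      is_kernel W -> density mu W F = density mu W F1 * density mu W F2].
Proof.
rewrite negb_forall => /existsP[x]; rewrite negb_forall => /existsP[y nxy].
pose C := [set z | connect (@adj F) x z]%SET.
have xC : x \in C by rewrite inE connect0.
have yC : y \in ~: C by rewrite !inE.
have C0 : (0 < #|C|)%N by apply/card_gt0P; exists x.
have D0 : (0 < #|~: C|)%N by apply/card_gt0P; exists y.
have cC : (#|C| + #|~: C| = nverts F)%N by rewrite cardsC card_ord.
exists (induced C0), (induced D0); split => [||d S R mu W kW] /=.
- by apply: leq_trans (eq_leq cC); rewrite -addn1 leq_add2l.
- by apply: leq_trans (eq_leq cC); rewrite -add1n leq_add2r.
pose h (k : 'I_(#|C| + #|~: C|)) : 'I_(nverts F) :=
  match fintype.split k with inl i => enum_val i | inr i => enum_val i end.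
have hl i : h (lshift _ i) = enum_val i by rewrite /h split_lshift.
have hr i : h (rshift _ i) = enum_val i by rewrite /h split_rshift.
have hI : injective h.
  move=> k k'; rewrite -[k]splitK -[k']splitK.
  case: (fintype.split k) => i; case: (fintype.split k') => j /=;
    rewrite ?hl ?hr => e.
  - by rewrite (enum_val_inj e).
  - by have := enum_valP j; rewrite -e inE (enum_valP i).
  - by have := enum_valP i; rewrite e inE (enum_valP j).
  - by rewrite (enum_val_inj e).
have hB : bijective h by apply: inj_card_bij => //; rewrite !card_ord cC.
apply: EFin_inj; rewrite EFinM !densityE //.
apply: (@kernel_density_union _ _ _ W kW mu F (induced C0) (induced D0) h hB).
- by move=> i j; rewrite !hl.
- by move=> i j; rewrite !hr.
move=> i j; rewrite hl hr; apply/negP => aij.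
have := enum_valP j; rewrite !inE => /negP; apply.
have := enum_valP i; rewrite inE => /connect_trans; apply; exact: connect1.
Qed.

(** Both sides are kernel densities, hence multiplicative, so the claim reduces to
    the components of [F]. *)
Lemma cvg_density_of_connected d (S : measurableType d) (R : realType)
    (mu : probability S R) W (nu : nat -> probability nat R) V :
  is_kernel W -> (forall j, is_kernel (V j)) ->
  (forall F, graph_connected F ->
    density (nu j) (V j) F @[j --> \oo] --> density mu W F) ->
  forall F, density (nu j) (V j) F @[j --> \oo] --> density mu W F.
Proof.
move=> kW kV conn F; have [m le_m] := ubnP (nverts F).
elim: m => // m IH in F le_m *.
have [/conn //|/disconnected_split] := boolP (graph_connected F).
move=> [F1 [F2 [lt1 lt2 E]]]; rewrite E //.
under eq_cvg do rewrite E //.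
by apply: cvgM; apply: IH; [exact: leq_trans lt1 _|exact: leq_trans lt2 _].
Qed.

(** * The weighted union of two graphs as a kernel *)

(** The vertices of [H] are [0, ..., h - 1], of mass [a / h] each, and those of [K]
    are [h, ..., h + k - 1], of mass [(1 - a) / k] each. *)
Lemma weighted_union (R : realType) (H K : sgraph) (a : R) : 0 < a < 1 ->
  exists (nu : probability nat R) (A : set nat), let V := nat_kernel R (sgraph_union H K) in
    [/\ forall F, graph_connected F -> density nu V F =
          a ^+ nverts F * hom_density R F H + (1 - a) ^+ nverts F * hom_density R F K,
        forall x y, A x -> ~ A y -> V (x, y) = 0 &
        nu A = a%:E].
Proof.
move=> /andP[a0 a1]; have b0 : 0 < 1 - a by rewrite subr_gt0.
pose h := nverts H; pose k := nverts K.
have h0 : 0 < h%:R :> R by rewrite ltr0n nverts_gt0.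
have k0 : 0 < k%:R :> R by rewrite ltr0n nverts_gt0.
pose w (i : 'I_(h + k)) : R :=
  match fintype.split i with inl _ => a / h%:R | inr _ => (1 - a) / k%:R end.
have wl i : w (lshift _ i) = a / h%:R by rewrite /w split_lshift.
have wr i : w (rshift _ i) = (1 - a) / k%:R by rewrite /w split_rshift.
have [||nu nuE] := @atomic_probability _ nat R (h + k) w val.
- by move=> i; rewrite /w; case: fintype.split => _; rewrite divr_ge0 // ltW.
- rewrite big_split_ord /=; under eq_bigr do rewrite wl.
  under [X in _ + X]eq_bigr do rewrite wr.
  rewrite !sumr_const !card_ord -[(a / _) *+ _]mulr_natr -[((1 - a) / _) *+ _]mulr_natr.
  by rewrite !divfK ?gt_eqF // addrC subrK.
have [||nu1 nu1E] := @atomic_probability _ nat R h (fun=> h%:R^-1) val.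
- by move=> i; rewrite invr_ge0 ltW.
- by rewrite sumr_const card_ord -[_^-1 *+ _]mulr_natr mulVf // gt_eqF.
have [||nu2 nu2E] := @atomic_probability _ nat R k (fun=> k%:R^-1) (fun i => h + i)%N.
- by move=> i; rewrite invr_ge0 ltW.
- by rewrite sumr_const card_ord -[_^-1 *+ _]mulr_natr mulVf // gt_eqF.
pose A : set nat := [set i | (i < h)%N].
pose V := nat_kernel R (sgraph_union H K).
have kV : is_kernel V by exact: nat_kernelP.
have VE (i j : 'I_(h + k)) : V (val i, val j) = (union_adj i j)%:R.
  exact: (@nat_kernelE R (sgraph_union H K)).
have mA : measurable A by [].
have muA g : measurable_fun setT g -> (forall x, 0 <= g x)%E ->
    (\int[nu]_x ((\1_A x)%:E * g x) = a%:E * \int[nu1]_x g x)%E.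
  move=> mg g0; rewrite nuE; last 2 first.
  - by [].
  - by move=> x; rewrite mule_ge0 // lee_fin indicE.
  rewrite nu1E // big_split_ord /= [X in (_ + X)%E]big1 ?adde0 => [|j _].
    rewrite ge0_sume_distrr => [|i _]; last by rewrite mule_ge0 // lee_fin invr_ge0 ltW.
    apply: eq_bigr => i _; rewrite wl indicE mem_set ?mul1e ?EFinM ?muleA //.
    exact: ltn_ord.
  rewrite indicE memNset ?mul0e ?mule0 // /A /=; apply/negP.
  by rewrite -leqNgt leq_addr.
have muB g : measurable_fun setT g -> (forall x, 0 <= g x)%E ->
    (\int[nu]_x ((\1_(~` A) x)%:E * g x) = (1 - a)%:E * \int[nu2]_x g x)%E.
  move=> mg g0; rewrite nuE; last 2 first.
  - by [].
  - by move=> x; rewrite mule_ge0 // lee_fin indicE.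
  rewrite nu2E // big_split_ord /= [X in (X + _)%E]big1 ?add0e => [|j _].
    rewrite ge0_sume_distrr => [|i _]; last by rewrite mule_ge0 // lee_fin invr_ge0 ltW.
    apply: eq_bigr => i _; rewrite wr indicE mem_set ?mul1e ?EFinM ?muleA //.
    by rewrite /A /=; apply/negP; rewrite -leqNgt leq_addr.
  rewrite indicE memNset ?mul0e ?mule0 // /A /= => nA; apply: nA; exact: ltn_ord.
have cross x y : A x -> ~ A y -> V (x, y) = 0.
  rewrite /A /= => xh /negP; rewrite -leqNgt => hy.
  rewrite /V /nat_kernel /nat_adj /=.
  case: insubP => // i _ ix; case: insubP => // j _ jy.
  rewrite /= /union_adj; case: (splitP i) => i' ei; case: (splitP j) => j' ej //.
    have : (h <= j')%N by rewrite -ej; move: hy; rewrite -jy.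
    by rewrite leqNgt ltn_ord.
  have : (h + i' < h)%N by rewrite -ei; move: xh; rewrite -ix.
  by rewrite ltnNge leq_addr.
exists nu, A; split => //.
  move=> F cF; apply: EFin_inj; rewrite densityE // EFinD !EFinM.
  rewrite (@kernel_density_mix _ _ _ V kV nu nu1 nu2 A a (1 - a)) //; try exact: ltW.
  - congr (_ * _ + _ * _)%E.
      apply: (@hom_density_kernel _ _ _ _ _ H F val) => // i j.
      rewrite -[val i]/(val (lshift k i)) -[val j]/(val (lshift k j)) VE.
      by rewrite /union_adj !split_lshift.
    apply: (@hom_density_kernel _ _ _ _ _ K F (fun i => h + i)%N) => // i j.
    rewrite -[(h + i)%N]/(val (rshift h i)) -[(h + j)%N]/(val (rshift h j)) VE.
    by rewrite /union_adj !split_rshift.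
  - rewrite /cut_mass; apply: integral0_eq => x _; apply: integral0_eq => y _.
    rewrite /cut_integrand !indicE /=.
    case: (boolP (x \in A)) => [/set_mem xA|_]; last by rewrite !mul0r.
    case: (boolP (y \in ~` A)) => [/set_mem yA|_]; last by rewrite mulr0.
    by rewrite cross // mulr0 mul0r.
have <- : (\int[nu]_x (\1_A x)%:E = nu A)%E by rewrite integral_indic // setIT.
transitivity (\int[nu]_x ((\1_A x)%:E * cst 1 x))%E.
  by apply: eq_integral => x _; rewrite mule1.
rewrite muA //.
rewrite (integral_cst nu1 measurableT 1%E) mul1e.
by have /= -> := probability_setT nu1; rewrite mule1.
Qed.

(** * Systems of internally disjoint paths *)

(** The edges of a path with new inner vertices [b, ..., b + k - 1] from [p] to
    the terminal [0].  Every edge is listed with its smaller end first, as long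
    as [0 < p < b]. *)
Fixpoint path_edges (p b k : nat) : seq (nat * nat) :=
  if k is k'.+1 then (p, b) :: path_edges b b.+1 k' else [:: (0, p)%N].

(** Paths from the terminal [1] to the terminal [0], with disjoint blocks of inner
    vertices starting at [b]. *)
Fixpoint paths (b : nat) (l : seq nat) : seq (seq (nat * nat)) :=
  if l is k :: l' then path_edges 1 b k :: paths (b + k) l' else [::].

Definition edge_below n (e : nat * nat) := (e.1 < e.2 < n)%N.

Lemma path_edges_below p b k n : (0 < p < b)%N -> (b + k <= n)%N ->
  all (edge_below n) (path_edges p b k).
Proof.
elim: k p b => [|k IH] p b /andP[p0 pb] /=; rewrite /edge_below /=.
  by rewrite addn0 p0 andbT; exact: leq_trans.
rewrite addnS pb /= => bk; rewrite (leq_trans _ bk) ?ltnS ?leq_addr //=.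
by apply: IH; rewrite ?ltnS ?leqnn ?(leq_ltn_trans _ pb) // addSn.
Qed.

Lemma path_edges_fst p b k e : (p < b)%N ->
  e \in path_edges p b k -> e.1 = 0%N \/ (p <= e.1)%N.
Proof.
elim: k p b => [|k IH] p b pb /=; first by rewrite inE => /eqP ->; left.
rewrite inE => /predU1P[->|/IH []] /=; [by right|exact: ltnSn|by left|].
by move=> be; right; exact: leq_trans (ltnW pb) be.
Qed.

Lemma path_edges_snd_ge p b k e : (p < b)%N ->
  e \in path_edges p b k -> (p <= e.2)%N.
Proof.
elim: k p b => [|k IH] p b pb /=; first by rewrite inE => /eqP ->.
rewrite inE => /predU1P[->|/IH]; first exact: ltnW.
by move=> /(_ (ltnSn _)) /(leq_trans (ltnW pb)).
Qed.

Lemma path_edges_snd p b k e : (0 < k)%N ->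
  e \in path_edges p b k -> (b <= e.2)%N.
Proof.
case: k => // k _; rewrite inE => /predU1P[-> //|].
exact: path_edges_snd_ge.
Qed.

(** The smaller ends [p, b, b + 1, ...] of the edges increase, and the last edge is
    the only one that ends at [0]. *)
Lemma path_edges_uniq p b k : (0 < p < b)%N -> uniq (path_edges p b k).
Proof.
elim: k p b => [//|k IH] p b /andP[p0 pb] /=.
rewrite IH ?andbT; last by rewrite ltnSn (ltn_trans p0).
apply/negP => /path_edges_fst -/(_ (ltnSn b)) [/= e|/=].
  by rewrite e in p0.
by rewrite leqNgt pb.
Qed.

Lemma paths_snd b l e : all (leq 1) l ->
  e \in flatten (paths b l) -> (b <= e.2)%N.
Proof.
elim: l b => [|k l IH] b //= /andP[k0 l0]; rewrite mem_cat => /orP[|/IH].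
  exact: path_edges_snd.
by move=> /(_ l0); apply: leq_trans; exact: leq_addr.
Qed.

Lemma paths_below b l n : (1 < b)%N -> (b + sumn l <= n)%N ->
  all (edge_below n) (flatten (paths b l)).
Proof.
elim: l b => [|k l IH] b //= b1; rewrite addnA => bn; rewrite all_cat.
rewrite path_edges_below ?IH //; last by apply: leq_trans bn; exact: leq_addr.
exact: leq_trans b1 (leq_addr _ _).
Qed.

(** The larger end of an edge is an inner vertex of its path as soon as the path
    has one.  This is why all path lengths are required to be positive: two
    direct edges between the terminals would coincide, and the weight of a
    multiple edge is not the density of a simple graph. *)
Lemma paths_uniq b l : (1 < b)%N -> all (leq 1) l -> uniq (flatten (paths b l)).
Proof.
elim: l b => [|k l IH] b //= b1 /andP[k0 l0]; rewrite cat_uniq.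
rewrite path_edges_uniq ?IH //; last exact: leq_trans b1 (leq_addr _ _).
rewrite andbT /=; apply/hasPn => e /(paths_snd l0) be; apply/negP => ke.
have /allP/(_ _ ke)/andP[_] := path_edges_below (p := 1) b1 (leqnn (b + k)).
by rewrite ltnNge be.
Qed.

(** * The path functional of a kernel *)

Section Paths.
Context d (S : measurableType d) (R : realType).
Variables (mu : probability S R) (W : S * S -> R).
Hypothesis kW : is_kernel W.
Variable x0 : S.

Let measW : measurable_fun setT W. Proof. by case: kW. Qed.
Let symW x y : W (x, y) = W (y, x). Proof. by case: kW. Qed.
Let W01 z : 0 <= W z <= 1. Proof. by case: kW. Qed.
Let W0 z : 0 <= W z. Proof. by case/andP: (W01 z). Qed.

Definition weight (s : seq (nat * nat)) (z : seq S) : R :=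
  \prod_(e <- s) W (nth x0 z e.1, nth x0 z e.2).

Definition avoid (L : seq (seq (nat * nat))) (z : seq S) : R :=
  \prod_(s <- L) (1 - weight s z).

Lemma weight01 s z : 0 <= weight s z <= 1.
Proof. by rewrite prodr_ge0 ?prodr_ile1. Qed.

Lemma avoid01 L z : 0 <= avoid L z <= 1.
Proof.
have h s : 0 <= 1 - weight s z <= 1 by move: (weight01 s z); lra.
by rewrite prodr_ge0 ?prodr_ile1 // => s _; case/andP: (h s).
Qed.

Lemma measurable_weight n s : measurable_fun setT (fun z : n.-tuple S => weight s z).
Proof.
have mn i : measurable_fun setT (fun z : n.-tuple S => nth x0 z i).
  have [i_n|n_i] := ltnP i n.
    rewrite (_ : (fun _ => _) = (@tnth n S)^~ (Ordinal i_n)).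
      exact: measurable_tnth.
    by apply/funext => z; rewrite (tnth_nth x0).
  rewrite (_ : (fun _ => _) = cst x0) //.
  by apply/funext => z; rewrite nth_default // size_tuple.
apply: measurable_prod_cond => e.
by apply: (measurableT_comp measW); exact: measurable_fun_pair.
Qed.

Lemma measurable_avoid n L : measurable_fun setT (fun z : n.-tuple S => avoid L z).
Proof.
apply: measurable_prod_cond => s; apply: measurable_funB => //.
exact: measurable_weight.
Qed.

(** The weight of the path from [p] to [x] with inner vertices [t]. *)
Fixpoint path_weight (p x : S) (t : seq S) : R :=
  if t is c :: t' then W (p, c) * path_weight c x t' else W (x, p).

Lemma weight_path_edges p b k z : (b + k <= size z)%N ->
  weight (path_edges p b k) z =
  path_weight (nth x0 z p) (nth x0 z 0) (take k (drop b z)).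
Proof.
elim: k p b => [|k IH] p b bk; first by rewrite take0 /weight /= big_seq1.
rewrite (drop_nth x0) /=; last by apply: leq_trans bk; rewrite addnS ltnS leq_addr.
by rewrite /weight big_cons -/(weight _ _) IH // addSnnS.
Qed.

(** Each path of the list takes its inner vertices from the front of [t], so the
    factors depend on disjoint sets of coordinates. *)
Fixpoint avoid_paths (l : seq nat) (x y : S) (t : seq S) : R :=
  if l is k :: l' then
    (1 - path_weight y x (take k t)) * avoid_paths l' x y (drop k t)
  else 1.

Lemma avoidE b l z : (b + sumn l <= size z)%N ->
  avoid (paths b l) z = avoid_paths l (nth x0 z 0) (nth x0 z 1) (drop b z).
Proof.
elim: l b => [|k l IH] b /=; first by rewrite /avoid big_nil.
rewrite addnA => bl; rewrite /avoid big_cons -/(avoid _ _) IH //.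
rewrite weight_path_edges ?drop_drop 1?addnC //.
by rewrite addnC (leq_trans _ bl) // leq_addr.
Qed.

(** The value at the pair [(x, y)] is the density of paths from [y] to [x] with [k]
    inner vertices. *)
Definition path_density (k : nat) (z : S * S) : R :=
  fine (iter_integral mu (fun t : k.-tuple S => (path_weight z.2 z.1 t)%:E)).

Lemma path_weight_weight k x y (t : k.-tuple S) :
  path_weight y x t = weight (path_edges 1 2 k) (x :: y :: t).
Proof.
rewrite weight_path_edges /= ?size_tuple // drop0.
by rewrite take_oversize // size_tuple.
Qed.

Lemma avoid_paths_avoid l x y (t : (sumn l).-tuple S) :
  avoid_paths l x y t = avoid (paths 2 l) (x :: y :: t).
Proof. by rewrite avoidE /= ?size_tuple // drop0. Qed.

Lemma path_weight01 p x t : 0 <= path_weight p x t <= 1.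
Proof.
elim: t p => [|c t IH] p /=; first exact: W01.
have := IH c; have := W01 (p, c).
by move=> /andP[a b] /andP[a' b']; rewrite mulr_ge0 //= mulr_ile1.
Qed.

Lemma measurable_path_weight k d' (T : measurableType d')
    (x y : T -> S) (t : T -> k.-tuple S) :
  measurable_fun setT x -> measurable_fun setT y -> measurable_fun setT t ->
  measurable_fun setT (fun z => path_weight (y z) (x z) (t z)).
Proof.
move=> mx my mt.
rewrite (_ : (fun _ => _) = (fun z => weight (path_edges 1 2 k)
    [tuple of x z :: [tuple of y z :: t z]])).
  apply: (measurableT_comp (f := fun z : k.+2.-tuple S => weight (path_edges 1 2 k) z)).
    exact: measurable_weight.
  by apply: measurable_cons => //; exact: measurable_cons.
by apply/funext => z; rewrite path_weight_weight.
Qed.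

Lemma path_densityE k z : (path_density k z)%:E =
  iter_integral mu (fun t : k.-tuple S => (path_weight z.2 z.1 t)%:E).
Proof.
have h0 : (0 <= iter_integral mu (fun t : k.-tuple S => (path_weight z.2 z.1 t)%:E))%E.
  by apply: iter_integral_ge0 => t; rewrite lee_fin; case/andP: (path_weight01 z.2 z.1 t).
rewrite fineK // ge0_fin_numE //; apply: (@le_lt_trans _ _ 1%E); last exact: ltry.
rewrite -(iter_integral_cst mu k 1%E); apply: le_iter_integral => //.
- by apply/measurable_EFinP; apply: measurable_path_weight.
- by move=> t; rewrite lee_fin; case/andP: (path_weight01 z.2 z.1 t).
- by move=> t; rewrite lee_fin; case/andP: (path_weight01 z.2 z.1 t).
Qed.

Lemma path_density01 k z : 0 <= path_density k z <= 1.
Proof.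
rewrite -!lee_fin path_densityE; apply/andP; split.
  by apply: iter_integral_ge0 => t; rewrite lee_fin; case/andP: (path_weight01 z.2 z.1 t).
rewrite -(iter_integral_cst mu k 1%E); apply: le_iter_integral => //.
- by apply/measurable_EFinP; apply: measurable_path_weight.
- by move=> t; rewrite lee_fin; case/andP: (path_weight01 z.2 z.1 t).
- by move=> t; rewrite lee_fin; case/andP: (path_weight01 z.2 z.1 t).
Qed.

Lemma measurable_path_density k : measurable_fun setT (path_density k).
Proof.
apply/measurable_EFinP.
rewrite (_ : _ \o _ = fun z => iter_integral mu (fun t : k.-tuple S =>
    (path_weight z.2 z.1 t)%:E)); last by apply/funext => z; exact: path_densityE.
apply: (@measurable_iter_integral_param _ _ _ mu k _ (S * S)%type
  (fun z : (S * S) * k.-tuple S => (path_weight z.1.2 z.1.1 z.2)%:E)).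
  apply/measurable_EFinP; apply: measurable_path_weight => //.
  - exact: (measurableT_comp measurable_fst measurable_fst).
  - exact: (measurableT_comp measurable_snd measurable_fst).
by move=> z; rewrite lee_fin; case/andP: (path_weight01 z.1.2 z.1.1 z.2).
Qed.

(** The first inner vertex [z] of a path starting at [y] is integrated separately. *)
Lemma path_densityS k x y : (path_density k.+1 (x, y))%:E =
  (\int[mu]_z ((W (y, z))%:E * (path_density k (x, z))%:E))%E.
Proof.
rewrite path_densityE iter_integralS /=; apply: eq_integral => z _.
rewrite path_densityE -iter_integralZl ?lee_fin //.
- by apply/measurable_EFinP; apply: measurable_path_weight.
- by move=> t; rewrite lee_fin; case/andP: (path_weight01 z x t).
Qed.

(** Once the terminals are fixed, paths through disjoint blocks of coordinates are
    independent. *)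
Lemma iter_integral_avoid_paths l x y :
  iter_integral mu (fun t : (sumn l).-tuple S => (avoid_paths l x y t)%:E) =
  (\prod_(k <- l) (1 - path_density k (x, y)))%:E.
Proof.
elim: l => [|k l IH]; first by rewrite big_nil.
rewrite big_cons EFinM -IH.
have P01 (t : seq S) := path_weight01 y x t.
have mP : measurable_fun setT (fun t : k.-tuple S => (path_weight y x t)%:E).
  by apply/measurable_EFinP; apply: measurable_path_weight.
have mP' : measurable_fun setT (fun t : k.-tuple S => (1 - path_weight y x t)%:E).
  apply/measurable_EFinP; apply: measurable_funB => //.
  by apply: measurable_path_weight.
have ge1 (t : seq S) : (0 <= (1 - path_weight y x t)%:E)%E.
  by rewrite lee_fin subr_ge0; case/andP: (P01 t).
have -> : (1 - path_density k (x, y))%:E = iter_integral mu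
    (fun t : k.-tuple S => (1 - path_weight y x t)%:E).
  rewrite EFinB path_densityE /=.
  rewrite -(iter_integral_cst mu k 1%E).
  rewrite (_ : (fun _ : k.-tuple S => 1%E) = (fun t : k.-tuple S =>
      (1 - path_weight y x t)%:E + (path_weight y x t)%:E)%E); last first.
    by apply/funext => t; rewrite -EFinD subrK.
  rewrite iter_integralD //.
    rewrite addeK // -(path_densityE k (x, y)) //.
  by move=> t; rewrite lee_fin; case/andP: (P01 t).
rewrite -iter_integralM //; first last.
- by move=> t; rewrite avoid_paths_avoid lee_fin; case/andP: (avoid01 (paths 2 l) (x :: y :: t)).
- apply/measurable_EFinP.
  rewrite (_ : (fun _ => _) = (fun t : (sumn l).-tuple S =>
    avoid (paths 2 l) [tuple of x :: [tuple of y :: t]])).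
    apply: (measurableT_comp (f := fun z : (sumn l).+2.-tuple S => avoid (paths 2 l) z)).
      exact: measurable_avoid.
    by apply: measurable_cons => //; exact: measurable_cons.
  by apply/funext => t; rewrite avoid_paths_avoid.
congr iter_integral; apply/funext => t; rewrite -EFinM; congr EFin; rewrite [LHS]/=.
congr ((1 - path_weight y x _) * avoid_paths l x y _).
  have kt : (k <= size t)%N by rewrite size_tuple; exact: leq_addr.
  apply: (@eq_from_nth _ x0); first by rewrite (size_takel kt) size_tuple.
  move=> i; rewrite (size_takel kt) => ik.
  rewrite nth_take // -(tnth_nth x0 _ (Ordinal ik)) tnth_comap.
  by rewrite (tnth_nth x0).
apply: (@eq_from_nth _ x0).
  by rewrite size_drop !size_tuple; exact: addKn.
move=> i; rewrite size_drop size_tuple => il0.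
have il : (i < sumn l)%N by move: il0; rewrite addKn.
by rewrite nth_drop -(tnth_nth x0 _ (Ordinal il)) tnth_comap (tnth_nth x0).
Qed.

(** The expectation over [n] random points of having weight on all edges of [s]
    and missing every path of [L]. *)
Definition path_functional n s L : \bar R :=
  iter_integral mu (fun z : n.-tuple S => (weight s z * avoid L z)%:E).

Lemma path_functional_paths l :
  path_functional (2 + sumn l) [::] (paths 2 l) =
  (\int[mu]_x \int[mu]_y (\prod_(k <- l) (1 - path_density k (x, y)))%:E)%E.
Proof.
rewrite /path_functional iter_integralS; apply: eq_integral => x _.
rewrite iter_integralS; apply: eq_integral => y _.
rewrite -iter_integral_avoid_paths; congr iter_integral; apply/funext => t.
by rewrite /weight big_nil mul1r avoid_paths_avoid.
Qed.

Let int0 s L (z : seq S) : (0 <= (weight s z * avoid L z)%:E)%E.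
Proof.
by rewrite lee_fin mulr_ge0 //; [case/andP: (weight01 s z)|case/andP: (avoid01 L z)].
Qed.

Let mint n s L :
  measurable_fun setT (fun z : n.-tuple S => (weight s z * avoid L z)%:E).
Proof.
apply/measurable_EFinP; apply: measurable_funM.
  exact: measurable_weight.
exact: measurable_avoid.
Qed.

Lemma path_functional_fin_num n s L : path_functional n s L \is a fin_num.
Proof.
rewrite ge0_fin_numE ?iter_integral_ge0 //.
apply: (@le_lt_trans _ _ 1%E); last exact: ltry.
rewrite -(iter_integral_cst mu n 1%E); apply: le_iter_integral => //.
move=> z; rewrite lee_fin.
have /andP[a b] := weight01 s z; have /andP[a' b'] := avoid01 L z.
exact: mulr_ile1.
Qed.

(** One step of inclusion-exclusion. *)
Lemma path_functional_cons n s r L :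
  path_functional n s (r :: L) =
  (path_functional n s L - path_functional n (s ++ r) L)%E.
Proof.
rewrite -[LHS](@addeK _ (path_functional n (s ++ r) L)) ?path_functional_fin_num //.
congr (_ - _)%E.
rewrite -iter_integralD //; congr iter_integral; apply/funext => z.
rewrite -EFinD; congr EFin; rewrite /avoid big_cons -/(avoid L z).
by rewrite /weight big_cat /=; ring.
Qed.

(** A repetition-free list of edges is a simple graph. *)
Lemma path_functional_density n s :
  all (edge_below n.+1) s -> uniq s ->
  path_functional n.+1 s [::] = kernel_density mu W (set_graph
    [set p : 'I_n.+1 * 'I_n.+1 | (val p.1, val p.2) \in s]%SET).
Proof.
move=> /allP sb us; rewrite kernel_densityE; congr iter_integral.
apply/funext => z; rewrite /avoid big_nil mulr1; congr EFin.
pose o (e : nat * nat) : 'I_n.+1 * 'I_n.+1 := (inord e.1, inord e.2).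
have oK e : e \in s -> (val (o e).1, val (o e).2) = e.
  case: e => i j /sb /andP[/= ij jn].
  by rewrite !inordK //; exact: ltn_trans ij jn.
have uo : uniq (map o s).
  rewrite map_inj_in_uniq // => e e' es es' ee'.
  by rewrite -(oK _ es) -(oK _ es') ee'.
transitivity (\prod_(p <- map o s) W (tnth z p.1, tnth z p.2)).
  rewrite big_map; apply: eq_big_seq => e es.
  by rewrite !(tnth_nth x0) -{1 2}(oK e es).
rewrite (big_uniq _ uo); apply: eq_bigl => -[p q].
transitivity ((val p, val q) \in s).
  apply/mapP/idP => [[e es [-> ->]]|pqs].
    by have := oK e es; rewrite /o /= => ->.
  exists (val p, val q) => //; rewrite /o /=; congr (_, _);
    by apply/val_inj; rewrite /= inord_val.
rewrite /= /set_adj !inE /=; case: (boolP ((val p, val q) \in s)) => pqs.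
  by have /andP[/= pq _] := sb _ pqs; rewrite pq.
by rewrite andbF /=; case: ltngtP.
Qed.

(** No path crosses the cut, so all paths are missed whenever the first terminal
    is in [A] and the second is not. *)
Lemma path_functional_cut_lb (A : set S) l :
  measurable A ->
  (forall x y, A x -> ~ A y -> W (x, y) = 0) ->
  (mu A * mu (~` A) <= path_functional (2 + sumn l) [::] (paths 2 l))%E.
Proof.
move=> mA cross.
have mB := measurableC mA.
have path0 p x t : A x -> ~ A p -> path_weight p x t = 0.
  move=> Ax; elim: t p => [|c t IH] p nAp /=; first exact: cross.
  have [Ac|nAc] := pselect (A c); first by rewrite symW cross // mul0r.
  by rewrite IH // mulr0.
have avoid1 x y t : A x -> ~ A y -> avoid_paths l x y t = 1.
  move=> Ax nAy; elim: (l) t => [//|k l' IH] t /=.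
  by rewrite path0 // subr0 mul1r IH.
pose h (z : S * S) : \bar R := ((\1_A z.1)%:E * (\1_(~` A) z.2)%:E)%E.
have mh : measurable_fun setT h.
  apply: emeasurable_funM; apply/measurable_EFinP.
    apply: (measurableT_comp (f := (\1_A : S -> R))); first exact: measurable_indic.
    exact: measurable_fst.
  apply: (measurableT_comp (f := (\1_(~` A) : S -> R))); first exact: measurable_indic.
  exact: measurable_snd.
have h0 z : (0 <= h z)%E by rewrite mule_ge0 // lee_fin indicE.
have -> : (mu A * mu (~` A) = \int[mu]_x \int[mu]_y h (x, y))%E.
  transitivity (\int[mu]_x ((\1_A x)%:E * mu (~` A)))%E.
    rewrite ge0_integralZr ?integral_indic ?setIT //.
    by apply/measurable_EFinP; exact: measurable_indic.
  apply: eq_integral => x _; rewrite /h /= ge0_integralZl //.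
  - by rewrite integral_indic // setIT.
  - by apply/measurable_EFinP; exact: measurable_indic.
rewrite -(@iter_integral_pair _ _ _ mu (2 + sumn l) (lshift _ ord0) (lshift _ ord_max) h) //.
apply: le_iter_integral => //.
  apply: (measurableT_comp mh); apply: measurable_fun_pair; exact: measurable_tnth.
move=> z; rewrite /weight big_nil mul1r /h /= -EFinM lee_fin avoidE ?size_tuple //.
rewrite !(tnth_nth x0) /= !indicE.
case: (boolP (_ \in A)) => [/set_mem z0A|_]; last first.
  rewrite mul0r -avoidE ?size_tuple //.
  by case/andP: (avoid01 (paths 2 l) z).
case: (boolP (_ \in ~` A)) => [/set_mem z1A|_]; last first.
  rewrite mulr0 -avoidE ?size_tuple //.
  by case/andP: (avoid01 (paths 2 l) z).
by rewrite avoid1 // mulr1.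
Qed.

End Paths.

Lemma ge0_integral_eq0 d (T : measurableType d) (R : realType)
    (mu : {measure set T -> \bar R}) (f : T -> \bar R) :
  measurable_fun setT f -> (forall x, 0 <= f x)%E ->
  (\int[mu]_x f x = 0)%E <-> {ae mu, forall x, f x = 0%E}.
Proof.
move=> mf f0; rewrite (_ : (\int[mu]_x f x = \int[mu]_x `|f x|)%E); last first.
  by apply: eq_integral => x _; rewrite gee0_abs.
rewrite (ae_eq_integral_abs mu measurableT mf); split; apply: filterS => x.
  by move=> /(_ I).
by move=> -> _.
Qed.

(** * A disconnected limit is represented by a disconnected kernel *)

(** Expanding by [path_functional_cons] leaves signed sums of densities of simple
    graphs, each of which converges. *)
Lemma cvg_path_functional d (S : measurableType d) (R : realType)
    (mu : probability S R) W x0 (nu : nat -> probability nat R) V n s L :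
  is_kernel W -> (forall j, is_kernel (V j)) ->
  (forall F, density (nu j) (V j) F @[j --> \oo] --> density mu W F) ->
  all (edge_below n.+1) (s ++ flatten L) -> uniq (s ++ flatten L) ->
  fine (path_functional (nu j) (V j) 0%N n.+1 s L) @[j --> \oo]
    --> fine (path_functional mu W x0 n.+1 s L).
Proof.
move=> kW kV cvgF; elim: L s => [|r L IH] s.
  rewrite /= cats0 => bs us.
  rewrite path_functional_density // -/(density _ _ _).
  by under eq_cvg do rewrite path_functional_density //; exact: cvgF.
rewrite /= => bsrL usrL.
have bs : all (edge_below n.+1) (s ++ flatten L).
  by move: bsrL; rewrite !all_cat => /and3P[-> _ ->].
have us : uniq (s ++ flatten L).
  apply: subseq_uniq usrL; apply: cat_subseq => //; exact: suffix_subseq.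
rewrite path_functional_cons // fineB ?path_functional_fin_num //.
under eq_cvg do rewrite path_functional_cons // fineB ?path_functional_fin_num //.
by apply: cvgB; apply: IH => //; rewrite -catA.
Qed.

(** The bound holds for the weighted unions of the graphs that converge to
    [Gamma1] and [Gamma2], and passes to the limit. *)
Lemma path_density_lb d (S : measurableType d) (R : realType)
    (mu : probability S R) W (Gamma Gamma1 Gamma2 : graph_limit R) (a : R) l :
  is_kernel W -> represents mu W Gamma -> 0 < a < 1 ->
  is_direct_sum a Gamma1 Gamma2 Gamma -> all (leq 1) l ->
  ((a * (1 - a))%:E <=
    \int[mu]_x \int[mu]_y (\prod_(k <- l) (1 - path_density mu W k (x, y)))%:E)%E.
Proof.
move=> kW rW a01 sumG l1.
have [H [_ cvgH]] := limit_densityP Gamma1.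
have [K [_ cvgK]] := limit_densityP Gamma2.
have /choice[nu /choice[A P]] j := weighted_union (H j) (K j) a01.
pose V j := nat_kernel R (sgraph_union (H j) (K j)).
have kV j : is_kernel (V j) by exact: nat_kernelP.
have cvgF F : density (nu j) (V j) F @[j --> \oo] --> density mu W F.
  apply: cvg_density_of_connected => // {}F cF.
  have -> : density mu W F = a ^+ nverts F * limit_density Gamma1 F
      + (1 - a) ^+ nverts F * limit_density Gamma2 F.
    by rewrite -sumG // /density -rW.
  under eq_cvg => j do have [-> // _ _] := P j.
  by apply: cvgD; apply: cvgM => //; exact: cvg_cst.
have x0 : S := point.
rewrite -(path_functional_paths mu kW x0 l) -[X in (_ <= X)%E]fineK; last first.
  exact: path_functional_fin_num.
rewrite lee_fin.
have cv : fine (path_functional (nu j) (V j) 0%N (2 + sumn l) [::] (paths 2 l))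
    @[j --> \oo] --> fine (path_functional mu W x0 (2 + sumn l) [::] (paths 2 l)).
  apply: cvg_path_functional => //; first exact: paths_below.
  exact: paths_uniq.
apply: (cvgr_to_ge cv); apply: nearW => j.
have [_ cross nuA] := P j.
rewrite -lee_fin fineK; last exact: path_functional_fin_num.
apply: le_trans (path_functional_cut_lb (nu j) (kV j) 0%N l _ cross) => //.
by rewrite probability_setC // nuA -EFinB -EFinM.
Qed.

Section Final.
Context d (S : measurableType d) (R : realType).
Variables (mu : probability S R) (W : S * S -> R).
Hypothesis kW : is_kernel W.

Let measW : measurable_fun setT W. Proof. by case: kW. Qed.
Let symW x y : W (x, y) = W (y, x). Proof. by case: kW. Qed.
Let W01 z : 0 <= W z <= 1. Proof. by case: kW. Qed.
Let W0 z : 0 <= W z. Proof. by case/andP: (W01 z). Qed.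

Local Notation P := (path_density mu W).
Let x0 : S := point.

Let P01 k z : 0 <= P k z <= 1. Proof. exact: path_density01. Qed.
Let mP k : measurable_fun setT (P k).
Proof. exact: (measurable_path_density mu kW x0). Qed.

Definition unlinked : set (S * S) := [set z | forall k, (0 < k)%N -> P k z = 0].

Lemma measurable_unlinked : measurable unlinked.
Proof.
rewrite (_ : unlinked = \bigcap_k (P k.+1 @^-1` [set 0])).
  apply: bigcapT_measurable => k; rewrite -[X in measurable X]setTI.
  by apply: mP => //; exact: measurable_set1.
apply/seteqP; split => z; first by move=> Zz k _; exact: Zz.
by move=> Zz [//|k] _; exact: Zz.
Qed.

Lemma avoid_power_le m t k z : k \in t ->
  \prod_(i <- flatten (nseq m t)) (1 - P i z) <= (1 - P k z) ^+ m.
Proof.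
have q01 i : 0 <= 1 - P i z <= 1 by move: (P01 i z); lra.
have q0 i : 0 <= 1 - P i z by case/andP: (q01 i).
move=> kt; elim: m => [|m IH] /=; first by rewrite big_nil expr0.
rewrite big_cat exprS; apply: ler_pM => //; try exact: prodr_ge0.
rewrite (big_rem k) //= ler_piMr //; exact: prodr_ile1.
Qed.

(** Apply the bound to the list containing each of [1, ..., m] with multiplicity
    [m].  At a pair with [P k z > 0] the integrand is at most
    [(1 - P k z) ^+ m] once [m >= k], so it tends to [0]; at an unlinked pair it
    is [1]. *)
Lemma unlinked_lb (c : \bar R) :
  (forall l, all (leq 1) l ->
    (c <= \int[mu]_x \int[mu]_y (\prod_(k <- l) (1 - P k (x, y)))%:E)%E) ->
  (c <= (mu \x mu)%E unlinked)%E.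
Proof.
move=> lb.
have q01 k z : 0 <= 1 - P k z <= 1 by move: (P01 k z); lra.
pose g (m : nat) (z : S * S) : \bar R :=
  (\prod_(k <- flatten (nseq m (iota 1 m))) (1 - P k z))%:E.
have g01 m z : (0 <= g m z <= 1)%E.
  rewrite !lee_fin prodr_ile1 ?prodr_ge0 // => k _; by case/andP: (q01 k z).
have g0 m z : (0 <= g m z)%E by case/andP: (g01 m z).
have mg m : measurable_fun setT (g m).
  apply/measurable_EFinP; apply: measurable_prod_cond => k.
  by apply: measurable_funB => //; exact: mP.
have cvg_g z : g m z @[m --> \oo] --> ((\1_unlinked z)%:E : \bar R).
  rewrite indicE; have [/set_mem zZ|/negP nZ] := boolP (z \in unlinked).
    apply: cvg_near_cst; apply: nearW => m; rewrite /g big_seq big1 // => k.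
    move=> /flattenP[_ /nseqP[-> _]]; rewrite mem_iota => /andP[k0 _].
    by rewrite zZ // subr0.
  have [k [k0 Pk]] : exists k, (0 < k)%N /\ P k z <> 0.
    apply: contrapT => h; apply: nZ; apply/mem_set => k k0.
    by apply: contrapT => Pk; apply: h; exists k.
  apply: cvg_EFin; first exact: nearW.
  have lt1 : `|1 - P k z| < 1.
    have /andP[Pk0 Pk1] := P01 k z.
    rewrite ger0_norm ?subr_ge0 // gtrBl lt0r Pk0 andbT; exact/eqP.
  apply: (@squeeze_cvgr _ _ _ _ (fun=> 0) (fun m => (1 - P k z) ^+ m) _).
  - near=> m; rewrite /= -lee_fin (g0 m z) /=; apply: avoid_power_le.
    rewrite mem_iota k0 add1n ltnS /=; near: m; exact: nbhs_infty_ge.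
  - exact: cvg_cst.
  - exact: cvg_expr.
have int1 : (mu \x mu)%E.-integrable setT (cst 1%E).
  apply/integrableP; split => //.
  rewrite (eq_integral (cst 1%E)) => [|z _]; last by rewrite gee0_abs.
  rewrite (integral_cst (mu \x mu)%E measurableT) mul1e.
  suff : ((mu \x mu)%E (setT `*` setT) < +oo)%E by rewrite setXTT.
  rewrite product_measure1E //.
  by have /= -> := probability_setT mu; rewrite mule1 ltry.
have mZ := measurable_unlinked.
have cvg_int : (\int[mu \x mu]_z g m z)%E @[m --> \oo]
    --> (\int[mu \x mu]_z (\1_unlinked z)%:E)%E.
  apply: (@dominated_cvg _ _ _ (mu \x mu)%E setT measurableT g _ (cst 1%E)) => //.
  by move=> m z _; rewrite gee0_abs //; case/andP: (g01 m z).
move: cvg_int; rewrite integral_indic // setIT; apply: cvge_ge.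
apply: nearW => m; rewrite fubini_tonelli1 //; apply: lb.
by apply/allP => k /flattenP[_ /nseqP[-> _]]; rewrite mem_iota => /andP[].
Unshelve. all: by end_near.
Qed.

Definition degree (x : S) : \bar R := (\int[mu]_y (W (x, y))%:E)%E.

Let mW : measurable_fun setT (EFin \o W). Proof. exact/measurable_EFinP. Qed.
Let mW1 x : measurable_fun setT (fun y => (W (x, y))%:E).
Proof. by apply: (measurableT_comp mW); exact: measurable_pair1. Qed.

Lemma measurable_degree : measurable_fun setT degree.
Proof.
by apply: (@measurable_fun_fubini_tonelli_F _ _ S S R mu (EFin \o W)) => //.
Qed.

Lemma degree_ge0 x : (0 <= degree x)%E.
Proof. by apply: integral_ge0 => y _; rewrite lee_fin. Qed.

(** The set of vertices of degree [0] has no edges to its complement, so it is null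
    or conull; in the latter case [W] vanishes almost everywhere. *)
Lemma connected_degree_pos : kernel_connected mu W ->
  {ae mu, forall x, degree x <> 0%E}.
Proof.
move=> cW; pose D := degree @^-1` [set 0%E].
have mD : measurable D.
  by rewrite -[D]setTI; apply: measurable_degree => //; exact: emeasurable_set1.
have D0 : mu D = 0%E.
  apply/eqP/negPn/negP => D0; apply: cW.
  have Dpos : (0 < mu D)%E by rewrite lt0e D0 measure_ge0.
  have [D1|D1] := ltP (mu D) 1%E; last first.
    left.
    have aeD : {ae mu, forall x, degree x = 0%E}.
      exists (~` D); split => //; first exact: measurableC.
      rewrite probability_setC // (_ : mu D = 1%E) ?subee //.
      by apply/eqP; rewrite eq_le D1 probability_le1.
    have int0 : (\int[mu \x mu]_z (EFin \o W) z = 0)%E.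
      rewrite fubini_tonelli1 //.
      apply/ge0_integral_eq0 => //; first exact: measurable_degree.
      exact: degree_ge0.
    move/ge0_integral_eq0 : int0 => /(_ mW) h.
    have {}h := h (fun z => W0 z).
    by apply: filterS h => z [].
  right; exists D; split => //; apply/(cut_mass_eq0 kW mu mD).
  rewrite /cut_mass; apply: integral0_eq => x _.
  have [xD|nxD] := pselect (D x); last first.
    apply: integral0_eq => y _; rewrite /cut_integrand indicE memNset //=.
    by rewrite !mul0r.
  have := xD; rewrite /D /= => dx.
  apply/eqP; rewrite eq_le; apply/andP; split; last first.
    by apply: integral_ge0 => y _; rewrite lee_fin cut_integrand_ge0.
  apply: (@le_trans _ _ (degree x)); last by rewrite dx.
  apply: ge0_le_integral => //.
  - by move=> y _; rewrite lee_fin cut_integrand_ge0.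
  - apply: (@measurableT_comp _ _ _ _ _ _ (EFin \o cut_integrand W D) _ (pair x)).
      by apply/measurable_EFinP; exact: measurable_cut_integrand.
    exact: measurable_pair1.
  - move=> y _; rewrite lee_fin /cut_integrand /= !indicE.
    by case: (x \in D); case: (y \in ~` D); rewrite ?mul1r ?mulr1 ?mul0r ?mulr0.
exists D; split => // x /= /contrapT; exact.
Qed.

(** Fix [x] of positive degree and let [B] be the set of points not linked to [x].
    For [y] in [B] the recursion for [path_density] gives [W (y, z) = 0] for
    almost every [z] linked to [x], so [B] has no edges to its complement.  Hence
    [B] is null unless it is conull; but then [P 1 (x, .)] vanishes almost
    everywhere, which forces [x] to have degree [0]. *)
Lemma connected_unlinked0 : kernel_connected mu W ->
  ((mu \x mu)%E unlinked = 0)%E.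
Proof.
move=> cW; have degpos := connected_degree_pos cW.
have mZ := measurable_unlinked.
rewrite /= /product_measure1.
apply/ge0_integral_eq0; [exact: measurable_fun_xsection| by []|].
apply: filterS (degpos) => x degx /=.
pose B := xsection unlinked x.
have mB : measurable B by exact: measurable_xsection.
have BE y : B y <-> forall k, (0 < k)%N -> P k (x, y) = 0.
  by rewrite /B /xsection /= inE.
rewrite -/B; apply/eqP/negPn/negP => B0.
have Bpos : (0 < mu B)%E by rewrite lt0e B0 measure_ge0.
have mP1 k : measurable_fun setT (fun y => (P k (x, y))%:E).
  by apply/measurable_EFinP; apply: (measurableT_comp (mP k)); exact: measurable_pair1.
have P0 k y : 0 <= P k (x, y) by case/andP: (P01 k (x, y)).
apply: cW; right; exists B; split => //; last first.
  apply/(cut_mass_eq0 kW mu mB); rewrite /cut_mass; apply: integral0_eq => y _.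
  have [yB|nyB] := pselect (B y); last first.
    by apply: integral0_eq => z _; rewrite /cut_integrand indicE memNset //= !mul0r.
  have ae0 : {ae mu, forall z, forall k, W (y, z) * P k.+1 (x, z) = 0}.
    apply: ae_foralln => k.
    have : (\int[mu]_z ((W (y, z))%:E * (P k.+1 (x, z))%:E) = 0)%E.
      by rewrite -(path_densityS mu kW x0); move/BE: yB => ->.
    move/ge0_integral_eq0 => h; have {}h := h (emeasurable_funM (mW1 y) (mP1 k.+1)).
    apply: filterS (h _) => z; last by rewrite mule_ge0 // lee_fin.
    by rewrite -EFinM => -[].
  apply/ge0_integral_eq0.
  - apply: (@measurableT_comp _ _ _ _ _ _ (EFin \o cut_integrand W B) _ (pair y)).
      by apply/measurable_EFinP; exact: measurable_cut_integrand.
    exact: measurable_pair1.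
  - by move=> z; rewrite lee_fin cut_integrand_ge0.
  apply: filterS ae0 => z Wz; congr EFin; rewrite /cut_integrand /= !indicE.
  have [/set_mem zB|] := boolP (z \in ~` B); last by rewrite mulr0.
  rewrite (_ : W (y, z) = 0) ?mulr0 ?mul0r //.
  apply: contrapT => Wyz; apply: zB; apply/BE => -[//|k] _.
  by have /eqP := Wz k; rewrite mulf_eq0 => /orP[/eqP //|/eqP].
rewrite lt_neqAle probability_le1 // andbT; apply/negP => /eqP B1.
apply: degx.
have aeB : {ae mu, forall y, B y}.
  exists (~` B); split => //; first exact: measurableC.
  by rewrite probability_setC // B1 subee.
have int0 : (\int[mu]_y (P 1 (x, y))%:E = 0)%E.
  apply/ge0_integral_eq0 => //; first by move=> y; rewrite lee_fin.
  by apply: filterS aeB => y /BE -> .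
(* Paths with one inner vertex z pass through an edge at x, and integrating over
   y turns the other edge into the degree of z. *)
have P1E y : ((P 1 (x, y))%:E = \int[mu]_z ((W (y, z))%:E * (W (x, z))%:E))%E.
  by rewrite path_densityE.
have : (\int[mu]_z ((W (x, z))%:E * degree z) = 0)%E.
  rewrite -[RHS]int0.
  under [RHS]eq_integral do rewrite P1E.
  rewrite (fubini_tonelli (fun z : S * S => ((W z)%:E * (W (x, z.2))%:E)%E)).
  - apply: eq_integral => z _; rewrite /degree -ge0_integralZl ?lee_fin //.
    + by apply: eq_integral => y _ /=; rewrite muleC symW.
    + by move=> y _; rewrite lee_fin.
  - apply: emeasurable_funM => //.
    apply: (measurableT_comp (mW1 x)); exact: measurable_snd.
  - by move=> z; rewrite mule_ge0 // lee_fin.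
move/ge0_integral_eq0 => /(_ (emeasurable_funM (mW1 x) measurable_degree)) h.
have ae0 : {ae mu, forall z, ((W (x, z))%:E * degree z = 0)%E}.
  by apply: h => z; rewrite mule_ge0 ?degree_ge0 // lee_fin.
apply/ge0_integral_eq0 => //; first by move=> y; rewrite lee_fin.
apply: filterS2 ae0 degpos => z /eqP; rewrite mule_eq0 => /orP[/eqP //|/eqP].
by move=> -> /(_ erefl).
Qed.

End Final.

Theorem theorem1p16 (R : realType) (d : measure_display) (S : measurableType d)
    (mu : probability S R) (W : S * S -> R) (Gamma : graph_limit R)
    (kernelW : is_kernel W) (reprW : represents mu W Gamma) :
  limit_connected Gamma <-> kernel_connected mu W.
Proof.
split => [cG dW|cW [Gamma1 [Gamma2 [a [a01 sumG]]]]].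
  exact: cG (limit_disconnected_of_kernel kernelW reprW dW).
have := @unlinked_lb _ _ _ mu W kernelW (a * (1 - a))%:E
  (fun l => path_density_lb kernelW reprW a01 sumG).
rewrite connected_unlinked0 // lee_fin; apply/negP; rewrite -ltNge.
by case/andP: a01 => a0 a1; rewrite mulr_gt0 // subr_gt0.
Qed.
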